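(* The system $\mathsf{RCA}_0^\omega+\mathsf{QF\text{-}AC}^{2,0}$ proves $(\exists^2)\leftrightarrow[\mathsf{FF}\wedge\neg\mathsf{MUC}]$, proves $(\exists^3)\leftrightarrow[\mathsf{FF}\wedge(Z^3)\wedge\neg\mathsf{MUC}]$, and proves \[(Z^3)\leftrightarrow\big[(\exists^3)\vee\neg(\exists^2)\big]\leftrightarrow\big[(\exists^3)\vee\neg\mathsf{FF}\vee\mathsf{MUC}\big].\]
   Context: Work in the language $\mathsf{L}_\omega$ of higher-order arithmetic with variables of all finite types: $0$ is the type of natural numbers and $\sigma\to\tau$ the type of mappings; $1=0\to0$, $2=1\to0$, $3=2\to0$. Equality at higher types is pointwise; $\le_\tau$ is defined pointwise using $\le_0$. $\mathsf{RCA}_0^\omega$ is Kohlenbach's base theory: basic axioms making $0,1,<,+,\times$ an ordered semiring, the combinators $K,S$, the recursor $\mathbf{R}_0$ ($\mathbf{R}_0(f,m,0)=m$, $\mathbf{R}_0(f,m,n+1)=f(\mathbf{R}_0(f,m,n))$), extensionality at all types, quantifier-free induction, and $\mathsf{QF\text{-}AC}^{1,0}$. $\mathsf{QF\text{-}AC}^{\sigma,\tau}$ is the schema $(\forall x^\sigma)(\exists y^\tau)A(x,y)\to(\exists Y^{\sigma\to\tau})(\forall x^\sigma)A(x,Y(x))$ for quantifier-free $A$. $\overline{f}n=\langle f(0),\dots,f(n-1)\rangle$; $C$ is the set of $f^1\le_1 1$. A chain $A_1\leftrightarrow A_2\leftrightarrow\cdots$ means each consecutive equivalence. $(\exists^2)$: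 $(\exists\varphi^2\le_2 1)(\forall f^1)\big[(\exists n^0)(f(n)=0)\leftrightarrow\varphi(f)=0\big]$. $(\exists^3)$: $(\exists E^3\le_3 1)(\forall Y^2)\big[(\exists f^1)(Y(f)=0)\leftrightarrow E(Y)=0\big]$. $(Z^3)$: $(\exists Z^3)(\forall Y^2)\big[Z(Y)=0\leftrightarrow(\forall f^1)(\exists N^0)(\forall g^1)(\overline fN=\overline gN\to Y(f)=Y(g))\big]$. $\mathsf{MUC}$: $(\exists\Omega^3)(\forall Y^2)(\forall f,g\in C)(\overline f\Omega(Y)=\overline g\Omega(Y)\to Y(f)=Y(g))$. $\mathsf{FF}$: $(\exists\Phi^3)(\forall Y^2\in\mathsf{cont})(\forall f,g\in C)(\overline f\Phi(Y)=\overline g\Phi(Y)\to Y(f)=Y(g))$, where $Y\in\mathsf{cont}$ means $(\forall f^1)(\exists N^0)(\forall g^1)(\overline fN=\overline gN\to Y(f)=Y(g))$. *)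

(* Defs.v *)
From Stdlib Require Import List.

Set Implicit Arguments.
Unset Strict Implicit.

Inductive ty : Type :=
| Nat : ty
| Arr : ty -> ty -> ty.

Declare Scope ty_scope.
Delimit Scope ty_scope with ty.
Bind Scope ty_scope with ty.
Notation "s ~> t" := (Arr s t) (at level 55, right associativity) : ty_scope.

Definition ty1 : ty := (Nat ~> Nat)%ty.
Definition ty2 : ty := (ty1 ~> Nat)%ty.
Definition ty3 : ty := (ty2 ~> Nat)%ty.

(** Typed de Bruijn syntax: a context lists the types of the free variables,
    the most recently bound one first. *)
Definition ctx : Type := list ty.

Inductive var : ctx -> ty -> Type :=
| VZ : forall G s, var (s :: G) s
| VS : forall G s t, var G t -> var (s :: G) t.
Arguments VZ {G s}.
Arguments VS {G s t} _.

Inductive tm (G : ctx) : ty -> Type :=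
| Var : forall s, var G s -> tm G s
| App : forall s t, tm G (s ~> t) -> tm G s -> tm G t
| Zero : tm G Nat
| One : tm G Nat
| Plus : tm G (Nat ~> Nat ~> Nat)
| Times : tm G (Nat ~> Nat ~> Nat)
| CombK : forall s t, tm G (s ~> t ~> s)
| CombS : forall r s t, tm G ((r ~> s ~> t) ~> (r ~> s) ~> r ~> t)
| Rec0 : tm G (ty1 ~> Nat ~> Nat ~> Nat).
Arguments Var {G s} _.
Arguments App {G s t} _ _.
Arguments Zero {G}.
Arguments One {G}.
Arguments Plus {G}.
Arguments Times {G}.
Arguments CombK {G s t}.
Arguments CombS {G r s t}.
Arguments Rec0 {G}.

(** The only atomic formulas are equations and inequalities of type 0. *)
Inductive fm (G : ctx) : Type :=
| Eq0 : tm G Nat -> tm G Nat -> fm G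
| Lt0 : tm G Nat -> tm G Nat -> fm G
| Bot : fm G
| And : fm G -> fm G -> fm G
| Or : fm G -> fm G -> fm G
| Imp : fm G -> fm G -> fm G
| All : forall s : ty, fm (s :: G) -> fm G
| Ex : forall s : ty, fm (s :: G) -> fm G.
Arguments Eq0 {G} _ _.
Arguments Lt0 {G} _ _.
Arguments Bot {G}.
Arguments And {G} _ _.
Arguments Or {G} _ _.
Arguments Imp {G} _ _.
Arguments All {G} s _.
Arguments Ex {G} s _.

Definition Not (G : ctx) (A : fm G) : fm G := Imp A Bot.
Definition Iff (G : ctx) (A B : fm G) : fm G := And (Imp A B) (Imp B A).

Declare Scope tm_scope.
Delimit Scope tm_scope with tm.
Bind Scope tm_scope with tm.
Notation "t · u" := (App t u) (at level 34, left associativity) : tm_scope.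
Notation "t + u" := (App (App Plus t) u) : tm_scope.
Notation "t * u" := (App (App Times t) u) : tm_scope.

Declare Scope fm_scope.
Delimit Scope fm_scope with fm.
Bind Scope fm_scope with fm.
Notation "t ≐ u" := (Eq0 t%tm u%tm) (at level 70) : fm_scope.
Notation "t ≺ u" := (Lt0 t%tm u%tm) (at level 70) : fm_scope.
Notation "A 'AND' B" := (And A B) (at level 80, right associativity) : fm_scope.
Notation "A 'OR' B" := (Or A B) (at level 85, right associativity) : fm_scope.
Notation "A ⊃ B" := (Imp A B) (at level 90, right associativity) : fm_scope.
Notation "A ⇔ B" := (Iff A B) (at level 95, no associativity) : fm_scope.
Notation "'NOT' A" := (Not A) (at level 75, right associativity) : fm_scope.

Local Open Scope tm_scope.
Local Open Scope fm_scope.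

Definition renaming (G D : ctx) : Type := forall s, var G s -> var D s.
Definition subst (G D : ctx) : Type := forall s, var G s -> tm D s.

Definition ren_up (G D : ctx) (r : ty) (f : renaming G D) :
    renaming (r :: G) (r :: D) :=
  fun s v =>
    match v in var G' s' return
      match G' with
      | nil => unit
      | r' :: G0 => renaming G0 D -> var (r' :: D) s'
      end
    with
    | VZ => fun _ => VZ
    | VS w => fun f => VS (f _ w)
    end f.

Fixpoint ren_tm (G D : ctx) (f : renaming G D) (s : ty) (t : tm G s) : tm D s :=
  match t with
  | Var v => Var (f _ v)
  | App a b => App (ren_tm f a) (ren_tm f b)
  | Zero => Zero
  | One => One
  | Plus => Plus
  | Times => Times
  | CombK => CombK
  | CombS => CombS
  | Rec0 => Rec0
  end.

Fixpoint ren_fm (G D : ctx) (f : renaming G D) (A : fm G) : fm D :=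
  match A with
  | Eq0 a b => Eq0 (ren_tm f a) (ren_tm f b)
  | Lt0 a b => Lt0 (ren_tm f a) (ren_tm f b)
  | Bot => Bot
  | And B C => And (ren_fm f B) (ren_fm f C)
  | Or B C => Or (ren_fm f B) (ren_fm f C)
  | Imp B C => Imp (ren_fm f B) (ren_fm f C)
  | All s B => All s (ren_fm (ren_up (r := s) f) B)
  | Ex s B => Ex s (ren_fm (ren_up (r := s) f) B)
  end.

Definition wk_tm (r : ty) (G : ctx) (s : ty) (t : tm G s) : tm (r :: G) s :=
  ren_tm (fun _ v => VS v) t.
Definition wk_fm (r : ty) (G : ctx) (A : fm G) : fm (r :: G) :=
  ren_fm (fun _ v => VS v) A.

Definition scons (G D : ctx) (r : ty) (t : tm D r) (f : subst G D) :
    subst (r :: G) D :=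
  fun s v =>
    match v in var G' s' return
      match G' with
      | nil => unit
      | r' :: G0 => tm D r' -> subst G0 D -> tm D s'
      end
    with
    | VZ => fun t _ => t
    | VS w => fun _ f => f _ w
    end t f.

Definition sub_up (G D : ctx) (r : ty) (f : subst G D) :
    subst (r :: G) (r :: D) :=
  scons (Var VZ) (fun s v => wk_tm r (f s v)).

Fixpoint sub_tm (G D : ctx) (f : subst G D) (s : ty) (t : tm G s) : tm D s :=
  match t with
  | Var v => f _ v
  | App a b => App (sub_tm f a) (sub_tm f b)
  | Zero => Zero
  | One => One
  | Plus => Plus
  | Times => Times
  | CombK => CombK
  | CombS => CombS
  | Rec0 => Rec0
  end.

Fixpoint sub_fm (G D : ctx) (f : subst G D) (A : fm G) : fm D :=
  match A with
  | Eq0 a b => Eq0 (sub_tm f a) (sub_tm f b)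
  | Lt0 a b => Lt0 (sub_tm f a) (sub_tm f b)
  | Bot => Bot
  | And B C => And (sub_fm f B) (sub_fm f C)
  | Or B C => Or (sub_fm f B) (sub_fm f C)
  | Imp B C => Imp (sub_fm f B) (sub_fm f C)
  | All s B => All s (sub_fm (sub_up (r := s) f) B)
  | Ex s B => Ex s (sub_fm (sub_up (r := s) f) B)
  end.

Definition inst (G : ctx) (r : ty) (A : fm (r :: G)) (t : tm G r) : fm G :=
  sub_fm (scons t (fun _ v => Var v)) A.

(** An axiom with free variables in [G] stands for its universal closure. *)
Definition theory : Type := forall G : ctx, fm G -> Prop.

Inductive prv (T : theory) : forall G : ctx, list (fm G) -> fm G -> Prop :=
| prv_ax : forall G (H : list (fm G)) A, T G A -> prv T H A
| prv_hyp : forall G (H : list (fm G)) A, In A H -> prv T H A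
| prv_raa : forall G (H : list (fm G)) A, prv T ((NOT A) :: H) Bot -> prv T H A
| prv_impI : forall G (H : list (fm G)) A B,
    prv T (A :: H) B -> prv T H (A ⊃ B)
| prv_impE : forall G (H : list (fm G)) A B,
    prv T H (A ⊃ B) -> prv T H A -> prv T H B
| prv_andI : forall G (H : list (fm G)) A B,
    prv T H A -> prv T H B -> prv T H (A AND B)
| prv_andE1 : forall G (H : list (fm G)) A B, prv T H (A AND B) -> prv T H A
| prv_andE2 : forall G (H : list (fm G)) A B, prv T H (A AND B) -> prv T H B
| prv_orI1 : forall G (H : list (fm G)) A B, prv T H A -> prv T H (A OR B)
| prv_orI2 : forall G (H : list (fm G)) A B, prv T H B -> prv T H (A OR B)
| prv_orE : forall G (H : list (fm G)) A B C,
    prv T H (A OR B) -> prv T (A :: H) C -> prv T (B :: H) C -> prv T H C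
| prv_allI : forall G (H : list (fm G)) s (A : fm (s :: G)),
    prv T (map (wk_fm s (G := G)) H) A -> prv T H (All s A)
| prv_allE : forall G (H : list (fm G)) s (A : fm (s :: G)) (t : tm G s),
    prv T H (All s A) -> prv T H (inst A t)
| prv_exI : forall G (H : list (fm G)) s (A : fm (s :: G)) (t : tm G s),
    prv T H (inst A t) -> prv T H (Ex s A)
| prv_exE : forall G (H : list (fm G)) s (A : fm (s :: G)) (C : fm G),
    prv T H (Ex s A) ->
    prv T (A :: map (wk_fm s (G := G)) H) (wk_fm s C) -> prv T H C
| prv_eq_refl : forall G (H : list (fm G)) (t : tm G Nat), prv T H (t ≐ t)
| prv_eq_subst : forall G (H : list (fm G)) (A : fm (Nat :: G)) (t u : tm G Nat),
    prv T H (t ≐ u) -> prv T H (inst A t) -> prv T H (inst A u).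

Definition proves (T : theory) (A : fm nil) : Prop := prv T nil A.

Definition le0 (G : ctx) (t u : tm G Nat) : fm G := t ≺ u OR t ≐ u.

Fixpoint eq_at (s : ty) (G : ctx) : tm G s -> tm G s -> fm G :=
  match s with
  | Nat => fun t u => t ≐ u
  | (r ~> s')%ty => fun t u =>
      All r (eq_at (wk_tm r t · Var VZ) (wk_tm r u · Var VZ))
  end.

Fixpoint le_at (s : ty) (G : ctx) : tm G s -> tm G s -> fm G :=
  match s with
  | Nat => fun t u => le0 t u
  | (r ~> s')%ty => fun t u =>
      All r (le_at (wk_tm r t · Var VZ) (wk_tm r u · Var VZ))
  end.

(** The constant-one functional, written just 1 in "phi <= 1". *)
Fixpoint one_at (s : ty) (G : ctx) : tm G s :=
  match s with
  | Nat => One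
  | (r ~> s')%ty => CombK · one_at s' G
  end.
Arguments one_at {s G}.

Fixpoint qf (G : ctx) (A : fm G) : Prop :=
  match A with
  | Eq0 _ _ | Lt0 _ _ | Bot => True
  | And B C | Or B C | Imp B C => qf B /\ qf C
  | All _ _ | Ex _ _ => False
  end.

(** For quantifier-free A(x,y), with y the variable bound last:
    (forall x, exists y, A(x,y)) -> exists Y, forall x, A(x,Y(x)). *)
Definition ac_instance (G : ctx) (s t : ty) (A : fm (t :: s :: G)) : fm G :=
  All s (Ex t A) ⊃
  Ex (s ~> t)
    (All s
      (sub_fm
        (scons (Var (VS VZ) · Var VZ)
          (scons (Var VZ) (fun _ v => Var (VS (VS v)))))
        A)).

Inductive QF_AC (s t : ty) : theory :=
| QF_AC_intro : forall G (A : fm (t :: s :: G)),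
    qf A -> QF_AC s t (ac_instance A).

Definition induction_instance (G : ctx) (A : fm (Nat :: G)) : fm G :=
  inst A Zero ⊃
  All Nat (A ⊃ sub_fm (scons (Var VZ + One) (fun _ v => Var (VS v))) A) ⊃
  All Nat A.

Inductive RCA0w : theory :=
(* The first sixteen axioms: ordered semiring, with 0 least and no element
   strictly between x and x + 1. *)
| ax_add_assoc : forall G (x y z : tm G Nat), RCA0w (x + (y + z) ≐ x + y + z)
| ax_add_comm : forall G (x y : tm G Nat), RCA0w (x + y ≐ y + x)
| ax_add_0 : forall G (x : tm G Nat), RCA0w (x + Zero ≐ x)
| ax_mul_assoc : forall G (x y z : tm G Nat), RCA0w (x * (y * z) ≐ x * y * z)
| ax_mul_comm : forall G (x y : tm G Nat), RCA0w (x * y ≐ y * x)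
| ax_mul_0 : forall G (x : tm G Nat), RCA0w (x * Zero ≐ Zero)
| ax_mul_1 : forall G (x : tm G Nat), RCA0w (x * One ≐ x)
| ax_distr : forall G (x y z : tm G Nat), RCA0w (x * (y + z) ≐ x * y + x * z)
| ax_lt_irrefl : forall G (x : tm G Nat), RCA0w (NOT x ≺ x)
| ax_lt_trans : forall G (x y z : tm G Nat),
    RCA0w (x ≺ y ⊃ y ≺ z ⊃ x ≺ z)
| ax_lt_total : forall G (x y : tm G Nat), RCA0w (x ≺ y OR x ≐ y OR y ≺ x)
| ax_lt_add : forall G (x y z : tm G Nat), RCA0w (x ≺ y ⊃ x + z ≺ y + z)
| ax_lt_mul : forall G (x y z : tm G Nat),
    RCA0w (x ≺ y ⊃ Zero ≺ z ⊃ x * z ≺ y * z)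
| ax_lt_0_1 : forall G, RCA0w (G := G) (Zero ≺ One)
| ax_not_lt_0 : forall G (x : tm G Nat), RCA0w (NOT x ≺ Zero)
| ax_lt_succ : forall G (x y : tm G Nat), RCA0w (x ≺ y + One ⊃ le0 x y)
| ax_K : forall G s t (x : tm G s) (y : tm G t), RCA0w (eq_at (CombK · x · y) x)
| ax_S : forall G r s t (x : tm G (r ~> s ~> t)) (y : tm G (r ~> s)) (z : tm G r),
    RCA0w (eq_at (CombS · x · y · z) (x · z · (y · z)))
| ax_rec_0 : forall G (f : tm G ty1) (m : tm G Nat),
    RCA0w (Rec0 · f · m · Zero ≐ m)
| ax_rec_S : forall G (f : tm G ty1) (m n : tm G Nat),
    RCA0w (Rec0 · f · m · (n + One) ≐ f · (Rec0 · f · m · n))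
| ax_ext : forall G s t (x y : tm G s) (F : tm G (s ~> t)),
    RCA0w (eq_at x y ⊃ eq_at (F · x) (F · y))
| ax_ind : forall G (A : fm (Nat :: G)), qf A -> RCA0w (induction_instance A)
| ax_QF_AC10 : forall G (A : fm G), QF_AC ty1 Nat A -> RCA0w A.

Inductive add_theory (T U : theory) : theory :=
| add_left : forall G (A : fm G), T G A -> add_theory T U A
| add_right : forall G (A : fm G), U G A -> add_theory T U A.

Definition RCA0w_QFAC20 : theory := add_theory RCA0w (QF_AC ty2 Nat).

Definition v0 {G : ctx} {a : ty} : tm (a :: G) a := Var VZ.
Definition v1 {G : ctx} {a b : ty} : tm (b :: a :: G) a := Var (VS VZ).
Definition v2 {G : ctx} {a b c : ty} : tm (c :: b :: a :: G) a :=
  Var (VS (VS VZ)).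
Definition v3 {G : ctx} {a b c d : ty} : tm (d :: c :: b :: a :: G) a :=
  Var (VS (VS (VS VZ))).

(** Equality of the finite sequences <f(0),...,f(n-1)> and <g(0),...,g(n-1)>,
    which have the same length, is equality of their entries. *)
Definition eq_initial (G : ctx) (f g : tm G ty1) (n : tm G Nat) : fm G :=
  All Nat (v0 ≺ wk_tm Nat n ⊃ wk_tm Nat f · v0 ≐ wk_tm Nat g · v0).

Definition in_C (G : ctx) (f : tm G ty1) : fm G := le_at f one_at.

(* bound variables, outermost first: f, N, g *)
Definition cont (G : ctx) (Y : tm G ty2) : fm G :=
  All ty1 (Ex Nat (All ty1
    (eq_initial v2 v0 v1 ⊃
     wk_tm ty1 (wk_tm Nat (wk_tm ty1 Y)) · v2 ≐
     wk_tm ty1 (wk_tm Nat (wk_tm ty1 Y)) · v0))).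

(* bound variables, outermost first: f, g *)
Definition modulus_on_C (G : ctx) (Y : tm G ty2) (n : tm G Nat) : fm G :=
  All ty1 (in_C v0 ⊃ All ty1 (in_C v0 ⊃
    eq_initial v1 v0 (wk_tm ty1 (wk_tm ty1 n)) ⊃
    wk_tm ty1 (wk_tm ty1 Y) · v1 ≐ wk_tm ty1 (wk_tm ty1 Y) · v0)).

(* bound variables, outermost first: phi, f, n *)
Definition Exists2 : fm nil :=
  Ex ty2 (le_at v0 one_at AND
    All ty1 (Ex Nat (v1 · v0 ≐ Zero) ⇔ v1 · v0 ≐ Zero)).

(* bound variables, outermost first: E, Y, f *)
Definition Exists3 : fm nil :=
  Ex ty3 (le_at v0 one_at AND
    All ty2 (Ex ty1 (v1 · v0 ≐ Zero) ⇔ v1 · v0 ≐ Zero)).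

(* bound variables, outermost first: Z, Y *)
Definition Z3 : fm nil :=
  Ex ty3 (All ty2 (v1 · v0 ≐ Zero ⇔ cont v0)).

(* bound variables, outermost first: Omega, Y *)
Definition MUC : fm nil :=
  Ex ty3 (All ty2 (modulus_on_C v0 (v1 · v0))).

(* bound variables, outermost first: Phi, Y *)
Definition FF : fm nil :=
  Ex ty3 (All ty2 (cont v0 ⊃ modulus_on_C v0 (v1 · v0))).

(* Main.v *)
(** The deduction system is complete for extensional applicative structures (Henkin
    construction followed by a quotient by extensional equality), so it suffices to argue in
    an arbitrary model, whose numbers may be nonstandard.

    There, a functional discontinuous at a point yields the Turing jump by Grilliot's trick;
    hence without the jump every Y is continuous, FF becomes MUC, and a constant functional
    witnesses (Z^3). Conversely the jump is discontinuous on C, which refutes MUC, and it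
    decides arithmetical statements: one can follow a path of nodes at which a continuous Y
    fails to be uniformly continuous, contradicting continuity at the limit of the path, and
    a search for a modulus on a countable dense set of binary sequences gives FF. Given
    the jump, Y has a zero iff (x, f) |-> [Y f = 0 and x has a zero] is discontinuous, so
    (Z^3) yields (exists^3); the converse holds since continuity only quantifies over types 0
    and 1. *)

From Stdlib Require Import List Arith Lia Cantor Classical ClassicalEpsilon.
From Stdlib Require Import FunctionalExtensionality PropExtensionality ProofIrrelevance.
From Stdlib Require Import Program.Equality.
Require Import Defs.

Set Implicit Arguments.
Unset Strict Implicit.

(** * Substitution *)

(** Inside a model, induction and choice reach only predicates that have a characteristic function
    in that model. The argument is therefore organised around closure properties of such predicates:
    choice along type 1 gives the atomic ones, recursion adds bounded number quantifiers, and the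
    jump adds unbounded ones. This is why functions are replaced by number codes wherever possible:
    the compactness argument for FF mentions only a countable dense set of binary sequences, so it
    stays arithmetical in Y, and the jump supplies both the induction and the choice of the path. In
    the completeness proof the obstacle is that contexts are finite lists, so no context holds all
    Henkin constants at once. The elements of the model are instead families of terms, one for each
    stage, that from some stage on agree up to weakening. *)

Lemma var_case (r : ty) (G : ctx) (P : forall s, var (r :: G) s -> Prop) :
  P r VZ -> (forall s (v : var G s), P s (VS v)) ->
  forall s (v : var (r :: G) s), P s v.
Proof. intros HZ HS s v. dependent destruction v; auto. Qed.

Lemma fam_ext (G : ctx) (F : ty -> Type) (f g : forall s, var G s -> F s) :
  (forall s v, f s v = g s v) -> f = g.
Proof.
  intros E. apply functional_extensionality_dep; intros s.
  apply functional_extensionality_dep; intros v. apply E.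
Qed.

Ltac by_var := apply fam_ext; apply var_case; simpl; try reflexivity.

Lemma ren_tm_sub_Var G D (f : renaming G D) s (t : tm G s) :
  ren_tm f t = sub_tm (fun s v => Var (f s v)) t.
Proof. induction t; simpl; congruence. Qed.

Lemma sub_tm_Var G s (t : tm G s) : sub_tm (fun s v => Var v) t = t.
Proof. induction t; simpl; congruence. Qed.

Lemma sub_tm_sub G D E (f : subst G D) (g : subst D E) s (t : tm G s) :
  sub_tm g (sub_tm f t) = sub_tm (fun s v => sub_tm g (f s v)) t.
Proof. induction t; simpl; congruence. Qed.

Lemma sub_tm_ren G D E (f : renaming G D) (g : subst D E) s (t : tm G s) :
  sub_tm g (ren_tm f t) = sub_tm (fun s v => g s (f s v)) t.
Proof. rewrite ren_tm_sub_Var, sub_tm_sub. reflexivity. Qed.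

Lemma ren_tm_sub G D E (f : subst G D) (g : renaming D E) s (t : tm G s) :
  ren_tm g (sub_tm f t) = sub_tm (fun s v => ren_tm g (f s v)) t.
Proof.
  rewrite ren_tm_sub_Var, sub_tm_sub. f_equal. apply fam_ext; intros.
  now rewrite ren_tm_sub_Var.
Qed.

Lemma sub_up_wk G D r (f : subst G D) s (t : tm G s) :
  sub_tm (sub_up (r := r) f) (wk_tm r t) = wk_tm r (sub_tm f t).
Proof. unfold wk_tm. rewrite sub_tm_ren, ren_tm_sub. reflexivity. Qed.

Lemma sub_scons_wk G D r (f : subst G D) (u : tm D r) s (t : tm G s) :
  sub_tm (scons u f) (wk_tm r t) = sub_tm f t.
Proof. unfold wk_tm. rewrite sub_tm_ren. reflexivity. Qed.

(** Seeing renamings as substitutions leaves a single composition law to prove for formulas. *)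
Lemma ren_fm_sub_Var G (A : fm G) D (f : renaming G D) :
  ren_fm f A = sub_fm (fun s v => Var (f s v)) A.
Proof.
  revert D f. induction A; intros D f; simpl;
    rewrite ?ren_tm_sub_Var; try (f_equal; auto; fail).
  - f_equal. rewrite IHA. f_equal. by_var.
  - f_equal. rewrite IHA. f_equal. by_var.
Qed.

Lemma sub_fm_Var G (A : fm G) : sub_fm (fun s v => Var v) A = A.
Proof.
  induction A; simpl; rewrite ?sub_tm_Var; try (f_equal; auto; fail).
  - f_equal. rewrite <- IHA at 2. f_equal. by_var.
  - f_equal. rewrite <- IHA at 2. f_equal. by_var.
Qed.

Lemma sub_fm_sub G (A : fm G) D E (f : subst G D) (g : subst D E) :
  sub_fm g (sub_fm f A) = sub_fm (fun s v => sub_tm g (f s v)) A.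
Proof.
  revert D E f g. induction A; intros D E f g; simpl;
    rewrite ?sub_tm_sub; try (f_equal; auto; fail).
  - f_equal. rewrite IHA. f_equal. by_var. intros; apply sub_up_wk.
  - f_equal. rewrite IHA. f_equal. by_var. intros; apply sub_up_wk.
Qed.

Lemma sub_fm_wk G D r (f : subst (r :: G) D) (A : fm G) :
  sub_fm f (wk_fm r A) = sub_fm (fun s v => f s (VS v)) A.
Proof. unfold wk_fm. now rewrite ren_fm_sub_Var, sub_fm_sub. Qed.

Lemma wk_fm_sub G D r (f : subst G D) (A : fm G) :
  wk_fm r (sub_fm f A) = sub_fm (fun s v => wk_tm r (f s v)) A.
Proof.
  unfold wk_fm. rewrite ren_fm_sub_Var, sub_fm_sub. f_equal.
  apply fam_ext; intros. unfold wk_tm. now rewrite ren_tm_sub_Var.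
Qed.

Lemma sub_up_wk_fm G D r (f : subst G D) (A : fm G) :
  sub_fm (sub_up (r := r) f) (wk_fm r A) = wk_fm r (sub_fm f A).
Proof. rewrite sub_fm_wk, wk_fm_sub. reflexivity. Qed.

Lemma inst_sub_up G D r (f : subst G D) (A : fm (r :: G)) (t : tm D r) :
  inst (sub_fm (sub_up (r := r) f) A) t = sub_fm (scons t f) A.
Proof.
  unfold inst. rewrite sub_fm_sub. f_equal. by_var.
  intros s v. rewrite sub_scons_wk. apply sub_tm_Var.
Qed.

Lemma sub_inst G D r (f : subst G D) (A : fm (r :: G)) (t : tm G r) :
  sub_fm f (inst A t) = inst (sub_fm (sub_up (r := r) f) A) (sub_tm f t).
Proof.
  rewrite inst_sub_up. unfold inst. rewrite sub_fm_sub. f_equal. by_var.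
Qed.

(** A [theory] by itself does not relate its axioms in different contexts; derivations can be moved
    between contexts once the images of axioms are axioms again. *)
Definition sub_closed (T : theory) : Prop :=
  forall G D (f : subst G D) A, T G A -> T D (sub_fm f A).

(** Allowing any [H'] that contains the images makes weakening of the hypotheses and weakening of
    the context special cases. *)
Lemma prv_sub (T : theory) (HT : sub_closed T) G (H : list (fm G)) A :
  prv T H A -> forall D (f : subst G D) (H' : list (fm D)),
  (forall B, In B H -> In (sub_fm f B) H') -> prv T H' (sub_fm f A).
Proof.
  assert (Hup : forall G D s (H : list (fm G)) (f : subst G D) (H' : list (fm D)),
    (forall B, In B H -> In (sub_fm f B) H') ->
    forall B, In B (map (wk_fm s (G := G)) H) ->
      In (sub_fm (sub_up (r := s) f) B) (map (wk_fm s (G := D)) H')).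
  { intros G0 D s H0 f H' HH B HB. apply in_map_iff in HB.
    destruct HB as [B0 [<- HB]]. rewrite sub_up_wk_fm. apply in_map. auto. }
  assert (Hcons : forall G D (C : fm G) (H : list (fm G)) (f : subst G D) (H' : list (fm D)),
    (forall B, In B H -> In (sub_fm f B) H') ->
    forall B, In B (C :: H) -> In (sub_fm f B) (sub_fm f C :: H')).
  { intros G0 D C H0 f H' HH B [<- | HB]; simpl; auto. }
  induction 1; intros D f H' HH; simpl.
  - apply prv_ax. now apply HT.
  - apply prv_hyp. auto.
  - apply prv_raa. apply (IHprv D f). now apply Hcons.
  - apply prv_impI. apply IHprv. now apply Hcons.
  - eapply prv_impE; [exact (IHprv1 D f H' HH) | auto].
  - apply prv_andI; auto.
  - eapply prv_andE1. exact (IHprv D f H' HH).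
  - eapply prv_andE2. exact (IHprv D f H' HH).
  - apply prv_orI1; auto.
  - apply prv_orI2; auto.
  - eapply prv_orE; [exact (IHprv1 D f H' HH) | |].
    + apply IHprv2. now apply Hcons.
    + apply IHprv3. now apply Hcons.
  - apply prv_allI. apply IHprv. now apply Hup.
  - rewrite sub_inst. apply prv_allE. exact (IHprv D f H' HH).
  - apply prv_exI with (t := sub_tm f t). rewrite <- sub_inst. auto.
  - eapply prv_exE; [exact (IHprv1 D f H' HH) |].
    rewrite <- sub_up_wk_fm. apply IHprv2. apply Hcons. now apply Hup.
  - apply prv_eq_refl.
  - rewrite sub_inst. eapply prv_eq_subst; [exact (IHprv1 D f H' HH) |].
    rewrite <- sub_inst. auto.
Qed.

Lemma prv_weaken (T : theory) (HT : sub_closed T) G (H H' : list (fm G)) A :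
  incl H H' -> prv T H A -> prv T H' A.
Proof.
  intros HH HA. rewrite <- (sub_fm_Var A). apply (prv_sub HT HA).
  intros B HB. rewrite sub_fm_Var. auto.
Qed.

Lemma prv_wk (T : theory) (HT : sub_closed T) G r (H : list (fm G)) (H' : list (fm (r :: G))) A :
  incl (map (wk_fm r (G := G)) H) H' -> prv T H A -> prv T H' (wk_fm r A).
Proof.
  intros HH HA. unfold wk_fm. rewrite ren_fm_sub_Var. apply (prv_sub HT HA).
  intros B HB. rewrite <- ren_fm_sub_Var. apply HH. now apply (in_map (wk_fm r (G := G))).
Qed.

(** * Completeness *)

Fixpoint default (s : ty) (G : ctx) : tm G s :=
  match s with
  | Nat => Zero
  | Arr r s' => App CombK (default s' G)
  end.

Fixpoint code_ty (s : ty) : nat :=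
  match s with
  | Nat => 0
  | Arr s t => S (to_nat (code_ty s, code_ty t))
  end.

Lemma to_nat_inj a b c d : to_nat (a, b) = to_nat (c, d) -> a = c /\ b = d.
Proof.
  intros E. apply (f_equal of_nat) in E. rewrite !cancel_of_to in E.
  now injection E.
Qed.

Lemma code_ty_inj s t : code_ty s = code_ty t -> s = t.
Proof.
  revert t. induction s; destruct t; simpl; intros E; try discriminate; auto.
  injection E as E. apply to_nat_inj in E. destruct E. f_equal; auto.
Qed.

Fixpoint code_var G s (v : var G s) : nat :=
  match v with
  | VZ => 0
  | VS w => S (code_var w)
  end.

Lemma code_var_inj G s (v w : var G s) : code_var v = code_var w -> v = w.
Proof.
  revert w. induction v; intros w E; dependent destruction w; simpl in E;
    try discriminate; auto.
  injection E as E. f_equal. auto.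
Qed.

(** The argument type of an application is recorded because the type of the result does not
    determine it; the indices of [CombK] and [CombS] can be read off the type of the term. *)
Fixpoint code_tm G s (t : tm G s) : nat :=
  match t with
  | Var v => to_nat (0, code_var v)
  | @App _ s0 _ a b => to_nat (1, to_nat (code_ty s0, to_nat (code_tm a, code_tm b)))
  | Zero => to_nat (2, 0)
  | One => to_nat (3, 0)
  | Plus => to_nat (4, 0)
  | Times => to_nat (5, 0)
  | CombK => to_nat (6, 0)
  | CombS => to_nat (7, 0)
  | Rec0 => to_nat (8, 0)
  end.

Ltac split_code :=
  repeat match goal with
  | E : to_nat _ = to_nat _ |- _ => apply to_nat_inj in E; destruct E
  end.

(** An occurs check: the types of [CombK] and [CombS] could coincide only if some t were equal to s
    ~> t. *)
Lemma arr_neq s t : t <> Arr s t.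
Proof.
  revert s. induction t; intros s E; [discriminate|].
  injection E as _ E. exact (IHt2 _ E).
Qed.

Lemma code_tm_inj G s (t u : tm G s) : code_tm t = code_tm u -> t = u.
Proof.
  revert u. induction t; intros u E; dependent destruction u;
    cbn [code_tm] in E; split_code; try discriminate; auto.
  - f_equal. now apply code_var_inj.
  - match goal with E : code_ty _ = code_ty _ |- _ => apply code_ty_inj in E; subst end.
    f_equal; auto.
  - destruct (arr_neq (eq_sym x0)).
  - destruct (arr_neq x0).
Qed.

Fixpoint code_fm G (A : fm G) : nat :=
  match A with
  | Eq0 a b => to_nat (0, to_nat (code_tm a, code_tm b))
  | Lt0 a b => to_nat (1, to_nat (code_tm a, code_tm b))
  | Bot => to_nat (2, 0)
  | And B C => to_nat (3, to_nat (code_fm B, code_fm C))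
  | Or B C => to_nat (4, to_nat (code_fm B, code_fm C))
  | Imp B C => to_nat (5, to_nat (code_fm B, code_fm C))
  | All s B => to_nat (6, to_nat (code_ty s, code_fm B))
  | Ex s B => to_nat (7, to_nat (code_ty s, code_fm B))
  end.

Lemma code_fm_inj G (A B : fm G) : code_fm A = code_fm B -> A = B.
Proof.
  revert B. induction A; intros B E; destruct B;
    cbn [code_fm] in E; split_code; try discriminate; auto;
    try (f_equal; auto using code_tm_inj; fail);
    match goal with E : code_ty _ = code_ty _ |- _ => apply code_ty_inj in E; subst end;
    f_equal; auto.
Qed.

Lemma surjection_of_code (X : Type) (x0 : X) (code : X -> nat) :
  (forall x y, code x = code y -> x = y) ->
  exists d : nat -> X, forall x, d (code x) = x.
Proof.
  intros Hc.
  exists (fun n => epsilon (inhabits x0) (fun x => code x = n)).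
  intros x. apply Hc.
  exact (epsilon_spec (inhabits x0) (fun y => code y = code x) (ex_intro _ x eq_refl)).
Qed.

(** * Henkin extension in stages *)

Section Henkin.

Variable T : theory.
Hypothesis HT : sub_closed T.
Variable start : list (fm nil).
Hypothesis start_cons : ~ prv T start Bot.

(* Stage [n] decides the formula [agenda n] and adds a fresh variable of type [stage_ty n],
   the witness if the decided formula is a true existential of that type. *)
Variable stage_ty : nat -> ty.

Fixpoint stage (n : nat) : ctx :=
  match n with
  | 0 => nil
  | S n => stage_ty n :: stage n
  end.

(** The types of the fresh variables are fixed beforehand because the formulas listed here live in
    the contexts that they generate. Each type and formula meet at arbitrarily late stages, so a
    formula comes up after its own stage and together with the type of its witness. *)
Variable agenda : nat -> {k : nat & fm (stage k)}.
Hypothesis agenda_spec : forall s x N, exists n,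
  N <= n /\ stage_ty n = s /\ agenda n = x.

Section Lift.
Variables (F : nat -> Type) (w : forall n, F n -> F (S n)) (d : forall n, F n).

(** Weakens an object of stage k up to stage m. Below k the value is a weakened default, so that any
    agenda entry can be read at any stage. *)
Fixpoint lift (x : {k : nat & F k}) (m : nat) : F m :=
  match eq_nat_dec (projT1 x) m with
  | left e => eq_rect _ F (projT2 x) m e
  | right _ => match m with 0 => d 0 | S m => w (lift x m) end
  end.

Lemma lift_at k (a : F k) : lift (existT _ k a) k = a.
Proof.
  destruct k; cbn [lift projT1 projT2];
    destruct (eq_nat_dec _ _) as [e|e];
    try congruence; now rewrite (proof_irrelevance _ e eq_refl).
Qed.

Lemma lift_S x m : projT1 x <= m -> lift x (S m) = w (lift x m).
Proof.
  intros Hm. cbn [lift]. destruct (eq_nat_dec (projT1 x) (S m)); [lia | reflexivity].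
Qed.

(** Stands for an object in the union of all stages, which has no context of its own. *)
Definition coherent (a : forall n, F n) : Prop :=
  exists N, forall n, N <= n -> a (S n) = w (a n).

Lemma lift_coherent x : coherent (lift x).
Proof. exists (projT1 x). intros. now apply lift_S. Qed.

Lemma lift_of_coherent (a : forall n, F n) N :
  (forall n, N <= n -> a (S n) = w (a n)) ->
  forall n, N <= n -> lift (existT _ N (a N)) n = a n.
Proof.
  intros Ha n Hn. induction Hn.
  - apply lift_at.
  - rewrite lift_S by auto. rewrite IHHn. symmetry. auto.
Qed.
End Lift.

Definition wk_stage_fm n (A : fm (stage n)) : fm (stage (S n)) := wk_fm (stage_ty n) A.
Definition wk_stage_tm s n (t : tm (stage n) s) : tm (stage (S n)) s := wk_tm (stage_ty n) t.

Definition todo (n : nat) : fm (stage n) :=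
  lift wk_stage_fm (fun n => Bot) (agenda n) n.

(** The body B already lives in the context of the next stage, its bound variable in the place of
    the fresh one, so it serves unchanged as the Henkin axiom. *)
Definition witness_axiom n (A : fm (stage n)) : list (fm (stage (S n))) :=
  match excluded_middle_informative (exists B, A = Ex (stage_ty n) B) with
  | left e => proj1_sig (constructive_indefinite_description _ e) :: nil
  | right _ => nil
  end.

Lemma witness_axiom_Ex n B : witness_axiom (Ex (stage_ty n) B) = B :: nil.
Proof.
  unfold witness_axiom.
  destruct (excluded_middle_informative _) as [e|e]; [|destruct e; eauto].
  destruct (constructive_indefinite_description _ e) as [B' HB']. simpl.
  dependent destruction HB'. reflexivity.
Qed.

Lemma witness_axiom_cases n (A : fm (stage n)) :
  witness_axiom A = nil \/ exists B, A = Ex (stage_ty n) B /\ witness_axiom A = B :: nil.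
Proof.
  destruct (classic (exists B, A = Ex (stage_ty n) B)) as [[B ->]|HA].
  - right. exists B. split; auto. apply witness_axiom_Ex.
  - left. unfold witness_axiom.
    destruct (excluded_middle_informative _); [contradiction | reflexivity].
Qed.

Fixpoint hyps (n : nat) : list (fm (stage n)) :=
  match n with
  | 0 => start
  | S n =>
      if excluded_middle_informative (prv T (todo n :: hyps n) Bot)
      then wk_stage_fm (Not (todo n)) :: map (@wk_stage_fm n) (hyps n)
      else witness_axiom (todo n) ++ wk_stage_fm (todo n) :: map (@wk_stage_fm n) (hyps n)
  end.

(** Generalise over the fresh variable and instantiate it by a closed term; this is where every type
    must be inhabited. *)
Lemma prv_Bot_strengthen G s (H : list (fm G)) :
  prv T (map (wk_fm s (G := G)) H) Bot -> prv T H Bot.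
Proof.
  intros HB. exact (prv_allE (A := Bot) (default s G) (prv_allI HB)).
Qed.

Lemma hyps_consistent n : ~ prv T (hyps n) Bot.
Proof.
  induction n as [|n IH]; [exact start_cons|]. cbn [hyps].
  destruct (excluded_middle_informative _) as [HA|HA]; intros HB.
  - assert (HB' : prv T (Not (todo n) :: hyps n) Bot).
    { apply (prv_Bot_strengthen (s := stage_ty n)). exact HB. }
    apply IH. exact (prv_impE (prv_impI HA) (prv_raa HB')).
  - destruct (witness_axiom_cases (todo n)) as [E|[B [E1 E2]]].
    + rewrite E in HB. apply HA. apply (prv_Bot_strengthen (s := stage_ty n)). exact HB.
    + rewrite E2 in HB. apply HA. apply prv_exE with (s := stage_ty n) (A := B).
      * rewrite <- E1. apply prv_hyp. simpl; auto.
      * exact HB.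
Qed.

Lemma hyps_wk n A : prv T (hyps n) A -> prv T (hyps (S n)) (wk_stage_fm A).
Proof.
  apply (prv_wk HT). cbn [hyps].
  destruct (excluded_middle_informative _); intros B HB; simpl; auto.
  apply in_or_app. simpl. auto.
Qed.

Definition True_at (a : forall n, fm (stage n)) : Prop :=
  exists N, forall n, N <= n -> prv T (hyps n) (a n).

Notation coherent_fm := (coherent wk_stage_fm).

Lemma True_at_of (a : forall n, fm (stage n)) N : (forall n, N <= n -> a (S n) = wk_stage_fm (a n)) ->
  prv T (hyps N) (a N) -> True_at a.
Proof.
  intros Ha HN. exists N. intros n Hn. induction Hn; auto.
  rewrite Ha by auto. now apply hyps_wk.
Qed.

Lemma True_at_map (a b : forall n, fm (stage n)) :
  (forall n, prv T (hyps n) (a n) -> prv T (hyps n) (b n)) -> True_at a -> True_at b.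
Proof. intros H [N Ha]. exists N. auto. Qed.

Lemma True_at_map2 (a b c : forall n, fm (stage n)) :
  (forall n, prv T (hyps n) (a n) -> prv T (hyps n) (b n) -> prv T (hyps n) (c n)) ->
  True_at a -> True_at b -> True_at c.
Proof.
  intros H [N Ha] [M Hb]. exists (max N M). intros n Hn.
  apply H; [apply Ha | apply Hb]; lia.
Qed.

Lemma True_at_Bot : ~ True_at (fun n => Bot).
Proof. intros [N H]. exact (hyps_consistent (H N (le_n N))). Qed.

Lemma todo_cofinal (a : forall n, fm (stage n)) s N0 : coherent_fm a ->
  exists n, N0 <= n /\ stage_ty n = s /\ todo n = a n /\
    forall m, n <= m -> a (S m) = wk_stage_fm (a m).
Proof.
  intros [N Ha].
  destruct (agenda_spec s (existT _ N (a N)) (max N N0)) as [n [Hn [Hs E]]].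
  exists n. split; [lia|]. split; auto. split.
  - unfold todo. rewrite E. apply lift_of_coherent with (a := a); auto. lia.
  - intros m Hm. apply Ha. lia.
Qed.

Lemma True_at_dec (a : forall n, fm (stage n)) : coherent_fm a -> True_at a \/ True_at (fun n => Not (a n)).
Proof.
  intros Ha. destruct (todo_cofinal Nat 0 Ha) as [n [_ [_ [E Hn]]]].
  destruct (classic (prv T (todo n :: hyps n) Bot)) as [HB|HB].
  - right. apply True_at_of with (S n).
    + intros m Hm. rewrite Hn by lia. reflexivity.
    + apply prv_hyp. rewrite Hn by auto. cbn [hyps].
      destruct (excluded_middle_informative _); [|contradiction].
      left. rewrite E. reflexivity.
  - left. apply True_at_of with (S n); [intros; apply Hn; lia|].
    apply prv_hyp. rewrite Hn by auto. cbn [hyps].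
    destruct (excluded_middle_informative _); [contradiction|].
    apply in_or_app. right. left. now rewrite E.
Qed.

Definition elem (s : ty) : Type := {x : forall n, tm (stage n) s | coherent (@wk_stage_tm s) x}.

Lemma inst_wk_under r G s (B : fm (s :: G)) (t : tm G s) :
  inst (ren_fm (ren_up (r := s) (fun s v => VS (s := r) v)) B) (wk_tm r t)
  = wk_fm r (inst B t).
Proof.
  unfold inst. rewrite wk_fm_sub, ren_fm_sub_Var, sub_fm_sub. f_equal. by_var.
Qed.

Lemma inst_wk_VZ G s (B : fm (s :: G)) :
  inst (ren_fm (ren_up (r := s) (fun _ v => VS (s := s) v)) B) (Var VZ) = B.
Proof.
  unfold inst. rewrite ren_fm_sub_Var, sub_fm_sub. rewrite <- (sub_fm_Var B) at 2.
  f_equal. by_var.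
Qed.

Lemma True_at_witness s (b : forall n, fm (s :: stage n)) :
  coherent_fm (fun n => Ex s (b n)) -> True_at (fun n => Ex s (b n)) ->
  exists x : elem s, True_at (fun n => inst (b n) (proj1_sig x n)).
Proof.
  intros Ha [N0 HT0].
  destruct (todo_cofinal s N0 Ha) as [n [HN0 [Hs [E Hn]]]]. subst s.
  (* The witness is the variable added at stage n, weakened to all later stages. *)
  pose (x0 := existT (fun k => tm (stage k) (stage_ty n)) (S n) (Var VZ)).
  pose (x := lift (@wk_stage_tm (stage_ty n)) (fun n => default _ _) x0).
  (* Coherence of the quantified formula passes to its body by injectivity of [Ex]. *)
  assert (Hb : forall m, n <= m -> b (S m) =
     ren_fm (ren_up (r := stage_ty n) (fun _ v => VS (s := stage_ty m) v)) (b m)).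
  { intros m Hm. specialize (Hn m Hm). unfold wk_stage_fm, wk_fm in Hn. simpl in Hn.
    dependent destruction Hn. assumption. }
  exists (exist _ x (lift_coherent _ _ _)). simpl.
  apply True_at_of with (S n).
  - intros m Hm. unfold x. rewrite lift_S by (simpl; lia). fold x.
    rewrite Hb by lia. apply inst_wk_under.
  - assert (Ex0 : inst (b (S n)) (x (S n)) = b n).
    { unfold x, x0. rewrite lift_at, Hb by auto. exact (inst_wk_VZ (b n)). }
    rewrite Ex0.
    apply prv_hyp. cbn [hyps].
    destruct (excluded_middle_informative _) as [HB|HB].
    + exfalso. apply (@hyps_consistent n). rewrite E in HB.
      exact (prv_impE (prv_impI HB) (HT0 n HN0)).
    + rewrite E, witness_axiom_Ex. left. reflexivity.
Qed.

End Henkin.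

(** * Structures, satisfaction and the term structure *)

Definition envs (F : ty -> Type) (G : ctx) : Type := forall s, var G s -> F s.

Definition econs (F : ty -> Type) (G : ctx) (r : ty) (x : F r) (e : envs F G) :
    envs F (r :: G) :=
  fun s v =>
    match v in var G' s' return
      match G' with
      | nil => unit
      | r' :: G0 => F r' -> envs F G0 -> F s'
      end
    with
    | VZ => fun x _ => x
    | VS w => fun _ e => e _ w
    end x e.

Definition enil (F : ty -> Type) : envs F nil :=
  fun s v => match v in var G' s' return match G' with nil => F s' | _ => unit end with
             | VZ => tt | VS _ => tt end.

Record structure := Structure {
  car : ty -> Type;
  ap : forall s t, car (Arr s t) -> car s -> car t;
  zero : car Nat;
  one : car Nat;
  plus_el : car (Arr Nat (Arr Nat Nat));
  times_el : car (Arr Nat (Arr Nat Nat));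
  K_el : forall s t, car (Arr s (Arr t s));
  S_el : forall r s t, car (Arr (Arr r (Arr s t)) (Arr (Arr r s) (Arr r t)));
  rec_el : car (Arr ty1 (Arr Nat (Arr Nat Nat)));
  eqN : car Nat -> car Nat -> Prop;
  ltN : car Nat -> car Nat -> Prop }.

Fixpoint eval (M : structure) G (e : envs (car M) G) s (t : tm G s) : car M s :=
  match t with
  | Var v => e _ v
  | App a b => ap (eval e a) (eval e b)
  | Zero => zero M
  | One => one M
  | Plus => plus_el M
  | Times => times_el M
  | CombK => K_el M _ _
  | CombS => S_el M _ _ _
  | Rec0 => rec_el M
  end.

Fixpoint sat (M : structure) G (e : envs (car M) G) (A : fm G) : Prop :=
  match A with
  | Eq0 t u => eqN (eval e t) (eval e u)
  | Lt0 t u => ltN (eval e t) (eval e u)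
  | Bot => False
  | And B C => sat e B /\ sat e C
  | Or B C => sat e B \/ sat e C
  | Imp B C => sat e B -> sat e C
  | All s B => forall x : car M s, sat (econs x e) B
  | Ex s B => exists x : car M s, sat (econs x e) B
  end.

Definition models (M : structure) (T : theory) : Prop :=
  forall G (A : fm G), T G A -> forall e : envs (car M) G, sat e A.

Lemma eval_sub (M : structure) G D (f : subst G D) (e : envs (car M) D) s (t : tm G s) :
  eval e (sub_tm f t) = eval (fun s v => eval e (f s v)) t.
Proof. induction t; simpl; congruence. Qed.

Lemma eval_wk (M : structure) G r (x : car M r) (e : envs (car M) G) s (t : tm G s) :
  eval (econs x e) (wk_tm r t) = eval e t.
Proof. unfold wk_tm. rewrite ren_tm_sub_Var, eval_sub. reflexivity. Qed.

Lemma sat_sub (M : structure) G (A : fm G) D (f : subst G D) (e : envs (car M) D) :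
  sat e (sub_fm f A) <-> sat (fun s v => eval e (f s v)) A.
Proof.
  assert (Hup : forall G D r (f : subst G D) (e : envs (car M) D) (x : car M r),
    (fun s v => eval (econs x e) (sub_up (r := r) f v)) = econs x (fun s v => eval e (f s v))).
  { intros. by_var. intros. apply eval_wk. }
  revert D f e. induction A; intros D f e; simpl; rewrite ?eval_sub;
    rewrite ?IHA1, ?IHA2; try tauto.
  - split; intros H x; specialize (H x); rewrite IHA, Hup in *; exact H.
  - split; intros [x H]; exists x; rewrite IHA, Hup in *; exact H.
Qed.

Section Term_structure.

Variable T : theory.
Hypothesis HT : sub_closed T.
Variable start : list (fm nil).
Hypothesis start_cons : ~ prv T start Bot.
Variable stage_ty : nat -> ty.
Variable agenda : nat -> {k : nat & fm (stage stage_ty k)}.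
Hypothesis agenda_spec : forall s x N, exists n,
  N <= n /\ stage_ty n = s /\ agenda n = x.

Notation El := (elem stage_ty).
Notation TrueH := (@True_at T start stage_ty agenda).
Notation coh := (coherent (@wk_stage_fm stage_ty)).

Definition const_elem s (t : forall G, tm G s) (Ht : forall G r, t (r :: G) = wk_tm r (t G)) : El s :=
  exist _ (fun n => t _) (ex_intro _ 0 (fun n _ => Ht _ _)).

Lemma elem_ap_coherent s t (x : El (Arr s t)) (y : El s) :
  coherent (@wk_stage_tm stage_ty t) (fun n => App (proj1_sig x n) (proj1_sig y n)).
Proof.
  destruct x as [x [N Hx]], y as [y [K Hy]]. exists (max N K). intros n Hn. simpl.
  rewrite Hx, Hy by lia. reflexivity.
Qed.

Definition elem_ap s t (x : El (Arr s t)) (y : El s) : El t :=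
  exist _ _ (elem_ap_coherent x y).

Definition term_structure : structure := {|
  car := El;
  ap := elem_ap;
  zero := const_elem (t := @Zero) (fun _ _ => eq_refl);
  one := const_elem (t := @One) (fun _ _ => eq_refl);
  plus_el := const_elem (t := @Plus) (fun _ _ => eq_refl);
  times_el := const_elem (t := @Times) (fun _ _ => eq_refl);
  K_el := fun s t => const_elem (t := fun G => @CombK G s t) (fun _ _ => eq_refl);
  S_el := fun r s t => const_elem (t := fun G => @CombS G r s t) (fun _ _ => eq_refl);
  rec_el := const_elem (t := @Rec0) (fun _ _ => eq_refl);
  eqN := fun x y => TrueH (fun n => Eq0 (proj1_sig x n) (proj1_sig y n));
  ltN := fun x y => TrueH (fun n => Lt0 (proj1_sig x n) (proj1_sig y n)) |}.

Definition at_stage G (e : envs El G) (n : nat) : subst G (stage stage_ty n) :=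
  fun s v => proj1_sig (e s v) n.

Lemma eval_term_structure G (e : envs El G) s (t : tm G s) n :
  proj1_sig (eval (M := term_structure) e t) n = sub_tm (at_stage e n) t.
Proof. induction t; simpl; try reflexivity. now rewrite IHt1, IHt2. Qed.

Lemma at_stage_coherent G (e : envs El G) : exists N, forall n, N <= n ->
  forall s (v : var G s), at_stage e (S n) v = wk_tm (stage_ty n) (at_stage e n v).
Proof.
  unfold at_stage. induction G as [|r G IH].
  - exists 0. intros n _ s v. inversion v.
  - destruct (IH (fun s v => e s (VS v))) as [N HN].
    destruct (proj2_sig (e r VZ)) as [K HK]. exists (max N K).
    intros n Hn. apply var_case.
    + apply HK. lia.
    + intros s v. apply (HN n); lia.
Qed.

Lemma sub_at_stage_coherent G (e : envs El G) (A : fm G) :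
  coh (fun n => sub_fm (at_stage e n) A).
Proof.
  destruct (at_stage_coherent e) as [N HN]. exists N. intros n Hn.
  unfold wk_stage_fm. rewrite wk_fm_sub. f_equal. apply fam_ext. auto.
Qed.

Lemma at_stage_econs G r (x : El r) (e : envs El G) n :
  at_stage (econs x e) n = scons (proj1_sig x n) (at_stage e n).
Proof. by_var. Qed.

Lemma prv_not_All G s (H : list (fm G)) (A : fm (s :: G)) :
  prv T H (Not (All s A)) -> prv T H (Ex s (Not A)).
Proof.
  intros HA. apply prv_raa.
  apply prv_impE with (All s A).
  - apply (prv_weaken HT) with H; [intros B HB; simpl; auto | exact HA].
  - apply prv_allI. apply prv_raa.
    apply prv_impE with (wk_fm s (Ex s (Not A))).
    + apply prv_hyp. simpl. auto.
    + apply prv_exI with (t := Var VZ).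
      match goal with |- prv _ _ ?X =>
        replace X with (Not A) by (symmetry; exact (inst_wk_VZ (Not A))) end.
      apply prv_hyp. simpl. auto.
Qed.

(** That the stages decide every formula settles disjunction and implication. A universal formula
    that is not true has a negated instance, found as a Henkin witness. *)
Lemma truth G (A : fm G) : forall e : envs El G,
  sat (M := term_structure) e A <-> TrueH (fun n => sub_fm (at_stage e n) A).
Proof.
  assert (dec : forall G (e : envs El G) A, TrueH (fun n => sub_fm (at_stage e n) A) \/
            TrueH (fun n => Not (sub_fm (at_stage e n) A))).
  { intros. apply True_at_dec; auto. apply sub_at_stage_coherent. }
  assert (contra : forall a, TrueH a -> TrueH (fun n => Not (a n)) -> False).
  { intros a H1 H2. apply (@True_at_Bot T start start_cons stage_ty agenda).
    revert H2 H1. apply True_at_map2. intros n. apply prv_impE. }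
  assert (inst_e : forall G r (A : fm (r :: G)) (e : envs El G) (x : El r) n,
    sub_fm (at_stage (econs x e) n) A = inst (sub_fm (sub_up (r := r) (at_stage e n)) A) (proj1_sig x n)).
  { intros. rewrite inst_sub_up, at_stage_econs. reflexivity. }
  induction A; intros e; simpl.
  - replace (fun n => Eq0 (sub_tm (at_stage e n) t) (sub_tm (at_stage e n) t0))
      with (fun n => Eq0 (proj1_sig (eval (M := term_structure) e t) n)
                         (proj1_sig (eval (M := term_structure) e t0) n)); [tauto|].
    apply functional_extensionality_dep. intros n. now rewrite !eval_term_structure.
  - replace (fun n => Lt0 (sub_tm (at_stage e n) t) (sub_tm (at_stage e n) t0))
      with (fun n => Lt0 (proj1_sig (eval (M := term_structure) e t) n)
                         (proj1_sig (eval (M := term_structure) e t0) n)); [tauto|].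
    apply functional_extensionality_dep. intros n. now rewrite !eval_term_structure.
  - split; [tauto|]. apply True_at_Bot. exact start_cons.
  - rewrite IHA1, IHA2. split.
    + intros [H1 H2]. revert H1 H2. apply True_at_map2. intros n. apply prv_andI.
    + intros H. split; revert H; apply True_at_map; intros n; [apply prv_andE1 | apply prv_andE2].
  - rewrite IHA1, IHA2. split.
    + intros [H|H]; revert H; apply True_at_map; intros n; [apply prv_orI1 | apply prv_orI2].
    + intros H. destruct (dec _ e A1) as [H1|H1]; auto.
      right. revert H H1. apply True_at_map2. intros n H H1.
      apply (prv_orE H); [|apply prv_hyp; simpl; auto].
      apply prv_raa. eapply prv_impE.
      * eapply (prv_weaken HT); [|exact H1]. intros B HB; simpl; auto.
      * apply prv_hyp. simpl. auto.
  - rewrite IHA1, IHA2. split.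
    + intros H. destruct (dec _ e A1) as [H1|H1].
      * apply H in H1. revert H1. apply True_at_map. intros n H1. apply prv_impI.
        eapply (prv_weaken HT); [|exact H1]. intros B HB; simpl; auto.
      * revert H1. apply True_at_map. intros n H1. apply prv_impI, prv_raa.
        eapply prv_impE; [eapply (prv_weaken HT); [|exact H1]; intros B HB; simpl; auto|].
        apply prv_hyp. simpl. auto.
    + intros H H1. revert H H1. apply True_at_map2. intros n. apply prv_impE.
  - split.
    + intros H. destruct (dec _ e (All s A)) as [H1|H1]; auto. exfalso. simpl in H1.
      assert (H2 : TrueH (fun n => Ex s (Not (sub_fm (sub_up (r := s) (at_stage e n)) A)))).
      { revert H1. apply True_at_map. intros n. apply prv_not_All. }
      apply True_at_witness in H2; auto.
      * destruct H2 as [x Hx]. specialize (H x). rewrite IHA in H.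
        apply (contra _ H). revert Hx. apply True_at_map. intros n. now rewrite inst_e.
      * exact (sub_at_stage_coherent e (Ex s (Not A))).
    + intros H x. rewrite IHA. revert H. apply True_at_map. intros n H.
      rewrite inst_e. now apply prv_allE.
  - split.
    + intros [x H]. rewrite IHA in H. revert H. apply True_at_map. intros n H.
      rewrite inst_e in H. now apply prv_exI with (proj1_sig x n).
    + intros H. apply True_at_witness in H; auto.
      * destruct H as [x Hx]. exists x. rewrite IHA. revert Hx. apply True_at_map.
        intros n. now rewrite inst_e.
      * exact (sub_at_stage_coherent e (Ex s A)).
Qed.

Lemma term_structure_models : models term_structure T.
Proof.
  intros G A HA e. apply truth. exists 0. intros n _. apply prv_ax. now apply HT.
Qed.

Lemma term_structure_start A : In A start -> sat (M := term_structure) (@enil _) A.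
Proof.
  intros HA. apply truth. exists 0. intros n _.
  apply (prv_sub HT) with (H := start); [now apply prv_hyp|].
  intros B HB. induction n as [|n IH].
  - simpl. replace (at_stage _ 0) with (fun s (v : var nil s) => Var v).
    + now rewrite sub_fm_Var.
    + apply fam_ext. intros s v. inversion v.
  - assert (E : sub_fm (at_stage (@enil El) (S n)) B = wk_stage_fm (sub_fm (at_stage (@enil El) n) B)).
    { unfold wk_stage_fm. rewrite wk_fm_sub. f_equal. apply fam_ext. intros s v. inversion v. }
    match goal with |- In ?X _ => replace X with (wk_stage_fm (sub_fm (at_stage (@enil El) n) B)) by (symmetry; exact E) end.
    cbn [hyps]. destruct (excluded_middle_informative _).
    + right. now apply in_map.
    + apply in_or_app. right. right. now apply in_map.
Qed.

(** Two variables are enough to extract symmetry and transitivity of [eqN] and its compatibility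
    with [ltN], by taking B atomic. *)
Lemma eqN_Leibniz (x y : El Nat) : TrueH (fun n => Eq0 (proj1_sig x n) (proj1_sig y n)) ->
  forall B : fm (Nat :: Nat :: nil), forall z : El Nat,
  sat (M := term_structure) (econs x (econs z (@enil _))) B ->
  sat (M := term_structure) (econs y (econs z (@enil _))) B.
Proof.
  intros E B z. rewrite !truth. revert E. simpl. apply True_at_map2.
  intros n E. rewrite !at_stage_econs. rewrite <- !inst_sub_up.
  now apply prv_eq_subst.
Qed.
End Term_structure.

(** * Extensional quotient and completeness *)

Fixpoint ext_eq (M : structure) (s : ty) : car M s -> car M s -> Prop :=
  match s with
  | Nat => fun x y => eqN x y
  | Arr r t => fun f g => forall x : car M r, ext_eq (ap f x) (ap g x)
  end.

Lemma sat_eq_at (M : structure) s : forall G (e : envs (car M) G) (t u : tm G s),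
  sat e (eq_at t u) <-> ext_eq (eval e t) (eval e u).
Proof.
  induction s as [|r _ s IH]; intros G e t u; simpl; [tauto|].
  split; intros H x; specialize (H x); rewrite IH in *; simpl in *;
    rewrite !eval_wk in *; exact H.
Qed.

(* Extensionality of application makes [ext_eq] a congruence, so that in the quotient equality
   at every type is Leibniz equality. *)
Section Quotient.

Variable M : structure.
Hypothesis eqN_refl : forall x : car M Nat, eqN x x.
Hypothesis eqN_sym : forall x y : car M Nat, eqN x y -> eqN y x.
Hypothesis eqN_trans : forall x y z : car M Nat, eqN x y -> eqN y z -> eqN x z.
Hypothesis ltN_eqN : forall x y x' y' : car M Nat, eqN x x' -> eqN y y' -> ltN x y -> ltN x' y'.
Hypothesis ap_ext : forall s t (F : car M (Arr s t)) x y,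
  ext_eq x y -> ext_eq (ap F x) (ap F y).

Lemma ext_eq_refl s (x : car M s) : ext_eq x x.
Proof. induction s; simpl; auto. Qed.
Lemma ext_eq_sym s (x y : car M s) : ext_eq x y -> ext_eq y x.
Proof. induction s; simpl in *; auto. Qed.
Lemma ext_eq_trans s (x y z : car M s) : ext_eq x y -> ext_eq y z -> ext_eq x z.
Proof. induction s; simpl in *; eauto. Qed.

Definition qcar (s : ty) : Type := {P : car M s -> Prop | exists x, P = @ext_eq M s x}.

Definition cls s (x : car M s) : qcar s := exist _ (@ext_eq M s x) (ex_intro _ x eq_refl).

Lemma cls_eq s (x y : car M s) : cls x = cls y <-> ext_eq x y.
Proof.
  split.
  - intros E. apply (f_equal (@proj1_sig _ _)) in E. simpl in E. rewrite E.
    apply ext_eq_refl.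
  - intros E. apply eq_sig_hprop; [intros; apply proof_irrelevance|]. simpl.
    apply functional_extensionality. intros z. apply propositional_extensionality.
    split; eauto using ext_eq_trans, ext_eq_sym.
Qed.

Lemma cls_surj s (p : qcar s) : exists x, cls x = p.
Proof.
  destruct p as [P [x ->]]. exists x. reflexivity.
Qed.

Definition rep_of s (p : qcar s) : car M s :=
  proj1_sig (constructive_indefinite_description _ (cls_surj p)).

Lemma cls_rep_of s (p : qcar s) : cls (rep_of p) = p.
Proof. unfold rep_of. destruct (constructive_indefinite_description _ _). auto. Qed.

Lemma rep_of_cls s (x : car M s) : ext_eq (rep_of (cls x)) x.
Proof. apply cls_eq. apply cls_rep_of. Qed.

Definition quotient : structure := {|
  car := qcar;
  ap := fun s t f x => cls (ap (rep_of f) (rep_of x));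
  zero := cls (zero M);
  one := cls (one M);
  plus_el := cls (plus_el M);
  times_el := cls (times_el M);
  K_el := fun s t => cls (K_el M s t);
  S_el := fun r s t => cls (S_el M r s t);
  rec_el := cls (rec_el M);
  eqN := eq;
  ltN := fun x y => ltN (rep_of x) (rep_of y) |}.

Lemma ap_cls s t (f : car M (Arr s t)) x :
  ap (s0 := quotient) (s := s) (t := t) (cls f) (cls x) = cls (ap f x).
Proof.
  simpl. apply cls_eq. apply ext_eq_trans with (ap (rep_of (cls f)) x).
  - apply ap_ext, rep_of_cls.
  - exact (rep_of_cls f x).
Qed.

Lemma eval_quotient G (e : envs (car M) G) s (t : tm G s) :
  eval (M := quotient) (fun s v => cls (e s v)) t = cls (eval e t).
Proof.
  induction t; try reflexivity. cbn [eval]. rewrite IHt1, IHt2. apply ap_cls.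
Qed.

Lemma sat_quotient G (A : fm G) : forall e : envs (car M) G,
  sat (M := quotient) (fun s v => cls (e s v)) A <-> sat e A.
Proof.
  assert (Hc : forall G s (x : car M s) (e : envs (car M) G),
    econs (F := qcar) (cls x) (fun s v => cls (e s v)) = fun s v => cls (econs x e v)).
  { intros. by_var. }
  induction A; intros e; cbn [sat]; rewrite ?eval_quotient;
    rewrite ?IHA1, ?IHA2; try tauto.
  - exact (cls_eq (s := Nat) _ _).
  - simpl. split; apply ltN_eqN; try exact (rep_of_cls (s := Nat) _); apply eqN_sym; exact (rep_of_cls (s := Nat) _).
  - split.
    + intros H x. specialize (H (cls x)). rewrite Hc, IHA in H. exact H.
    + intros H p. destruct (cls_surj p) as [x <-]. rewrite Hc, IHA. auto.
  - split.
    + intros [p H]. destruct (cls_surj p) as [x <-]. rewrite Hc, IHA in H. eauto.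
    + intros [x H]. exists (cls x). rewrite Hc, IHA. auto.
Qed.

Lemma quotient_models T : models M T -> models quotient T.
Proof.
  intros HM G A HA e.
  replace e with (fun s v => cls (rep_of (e s v))).
  - apply sat_quotient. now apply HM.
  - apply fam_ext. intros. apply cls_rep_of.
Qed.

Lemma quotient_ext s t (f g : car quotient (Arr s t)) :
  (forall x, ap f x = ap g x) -> f = g.
Proof.
  destruct (cls_surj f) as [f0 <-], (cls_surj g) as [g0 <-]. intros H.
  apply cls_eq. intros x. apply cls_eq. rewrite <- !ap_cls. apply H.
Qed.
End Quotient.

Definition standard_eq (M : structure) : Prop := forall x y : car M Nat, eqN x y <-> x = y.

Definition extensional (M : structure) : Prop :=
  forall s t (f g : car M (Arr s t)), (forall x, ap f x = ap g x) -> f = g.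

Theorem completeness (T : theory) (A : fm nil) :
  sub_closed T ->
  (forall G s t (x y : tm G s) (F : tm G (Arr s t)),
    T G (Imp (eq_at x y) (eq_at (App F x) (App F y)))) ->
  (forall M, models M T -> standard_eq M -> extensional M -> sat (M := M) (@enil _) A) ->
  proves T A.
Proof.
  intros HT Hext HA. apply NNPP. intros Hn.
  assert (Hc : ~ prv T (Not A :: nil) Bot) by (intros H; apply Hn; now apply prv_raa).
  destruct (surjection_of_code Nat code_ty_inj) as [dty Hdty].
  pose (stage_ty := fun n => dty (fst (of_nat n))).
  pose (X := {k : nat & fm (stage stage_ty k)}).
  destruct (@surjection_of_code X (existT _ 0 Bot)
    (fun x => to_nat (projT1 x, code_fm (projT2 x)))) as [dX HdX].
  { intros [k B] [l C] E. simpl in E. apply to_nat_inj in E. destruct E as [-> E].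
    apply code_fm_inj in E. now subst. }
  pose (agenda := fun n => dX (fst (of_nat (snd (of_nat n)))) : X).
  assert (Hag : forall s x N, exists n, N <= n /\ stage_ty n = s /\ agenda n = x).
  { intros s x N.
    (* The last component N pushes the index beyond N, so every pair of a type and a formula
       recurs. *)
    pose (m := to_nat (to_nat (projT1 x, code_fm (projT2 x)), N)).
    exists (to_nat (code_ty s, m)). unfold stage_ty, agenda.
    rewrite cancel_of_to. simpl. unfold m. rewrite cancel_of_to. simpl.
    split; [|split; [apply Hdty | exact (HdX x)]].
    pose proof (to_nat_non_decreasing (code_ty s) m).
    pose proof (to_nat_non_decreasing (to_nat (projT1 x, code_fm (projT2 x))) N).
    unfold m in *. lia. }
  pose (M0 := @term_structure T (Not A :: nil) stage_ty agenda).
  assert (HM0 : models M0 T) by (now apply term_structure_models).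
  assert (HL := eqN_Leibniz HT Hc Hag). fold M0 in HL.
  assert (Hrefl : forall x : car M0 Nat, eqN x x).
  { intros x. exists 0. intros. apply prv_eq_refl. }
  assert (Hsym : forall x y : car M0 Nat, eqN x y -> eqN y x).
  { intros x y E. exact (HL x y E (Eq0 v0 v1) x (Hrefl x)). }
  assert (Htrans : forall x y z : car M0 Nat, eqN x y -> eqN y z -> eqN x z).
  { intros x y z E1 E2. exact (HL y z E2 (Eq0 v1 v0) x E1). }
  assert (Hlt : forall x y x' y' : car M0 Nat, eqN x x' -> eqN y y' -> ltN x y -> ltN x' y').
  { intros x y x' y' E1 E2 L. apply (HL y y' E2 (Lt0 v1 v0) x').
    exact (HL x x' E1 (Lt0 v0 v1) y L). }
  assert (Hap : forall s t (F : car M0 (Arr s t)) x y, ext_eq x y -> ext_eq (ap F x) (ap F y)).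
  { intros s t F x y E.
    pose proof (HM0 _ _ (Hext (Arr s t :: s :: s :: nil) s t v1 v2 v0)
      (econs F (econs x (econs y (@enil _))))) as H.
    cbn [sat] in H. rewrite !sat_eq_at in H. exact (H E). }
  pose (M := quotient M0).
  assert (HA' : sat (M := M) (@enil _) A).
  { apply HA.
    - now apply quotient_models.
    - intros x y. reflexivity.
    - intros s t. now apply quotient_ext. }
  assert (HA0 : sat (M := M0) (@enil _) A).
  { apply (sat_quotient Hrefl Hsym Htrans Hlt Hap).
    match goal with |- sat ?e A => replace e with (@enil (qcar M0)) end; [exact HA'|].
    apply fam_ext. intros s v. inversion v. }
  assert (HnA := term_structure_start HT Hc Hag (or_introl eq_refl)).
  exact (HnA HA0).
Qed.

(** * Arithmetic and definability in a model *)

Lemma sub_eq_at s : forall G D (f : subst G D) (t u : tm G s),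
  sub_fm f (eq_at t u) = eq_at (sub_tm f t) (sub_tm f u).
Proof.
  induction s as [|r _ s IH]; intros G D f t u; simpl; [reflexivity|].
  rewrite IH. simpl. now rewrite !sub_up_wk.
Qed.

Lemma qf_sub G (A : fm G) : forall D (f : subst G D), qf A -> qf (sub_fm f A).
Proof. induction A; simpl; intros D f HA; try tauto; destruct HA; auto. Qed.

Lemma sub_closed_QF_AC s t : sub_closed (QF_AC s t).
Proof.
  intros G D f A0 HA. revert D f. destruct HA as [G A HA]. intros D f.
  replace (sub_fm f (ac_instance A))
    with (ac_instance (sub_fm (sub_up (r := t) (sub_up (r := s) f)) A)).
  - constructor. now apply qf_sub.
  - unfold ac_instance. simpl. do 3 f_equal. rewrite !sub_fm_sub. f_equal.
    apply fam_ext. apply var_case; [reflexivity|]. apply var_case; [reflexivity|].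
    intros r v. simpl. rewrite !sub_scons_wk.
    unfold wk_tm. rewrite !ren_tm_sub_Var, !sub_tm_sub. reflexivity.
Qed.

Lemma sub_closed_RCA0w : sub_closed RCA0w.
Proof.
  intros G D f A0 HA. revert D f.
  destruct HA; intros D g; try (constructor; fail); try (simpl; constructor; fail).
  - rewrite sub_eq_at. constructor.
  - rewrite sub_eq_at. constructor.
  - simpl. rewrite !sub_eq_at. constructor.
  - replace (sub_fm g (induction_instance A))
      with (induction_instance (sub_fm (sub_up (r := Nat) g) A)).
    + constructor. now apply qf_sub.
    + unfold induction_instance. simpl. rewrite sub_inst. do 4 f_equal.
      rewrite !sub_fm_sub. f_equal. by_var.
      intros s v. rewrite sub_scons_wk. unfold wk_tm. now rewrite ren_tm_sub_Var.
  - apply ax_QF_AC10. now apply sub_closed_QF_AC.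
Qed.

Lemma sub_closed_RCA0w_QFAC20 : sub_closed RCA0w_QFAC20.
Proof.
  intros G D f A HA. revert D f. destruct HA as [G A HA|G A HA]; intros D f.
  - apply add_left. now apply sub_closed_RCA0w.
  - apply add_right. now apply sub_closed_QF_AC.
Qed.

(** * The base theory in an extensional model with true equality *)

Section Model.

Variable M : structure.
Hypothesis HM : models M RCA0w.
Hypothesis M_eq : standard_eq M.
Hypothesis M_ext : extensional M.

Notation N := (car M Nat).
Notation el := (car M).
Notation "f • x" := (@ap M _ _ f x) (at level 11, left associativity).
Notation "0" := (zero M).
Notation "1" := (one M).
Notation "x + y" := (plus_el M • x • y).
Notation "x * y" := (times_el M • x • y).
Notation "x < y" := (@ltN M x y).
Notation "x <= y" := (@ltN M x y \/ x = y).

Lemma eqN_eq (x y : N) : eqN x y <-> x = y.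
Proof. apply M_eq. Qed.

Lemma ext_eq_eq s (x y : el s) : ext_eq x y <-> x = y.
Proof.
  induction s as [|r _ s IH]; simpl; [apply eqN_eq|]. split.
  - intros E. apply M_ext. intros z. apply IH, E.
  - intros -> z. now apply IH.
Qed.

Lemma K_spec s t (x : el s) (y : el t) : K_el M s t • x • y = x.
Proof.
  pose proof (HM (ax_K (v1 : tm (t :: s :: nil) s) v0) (econs y (econs x (@enil _)))) as P.
  rewrite sat_eq_at, ext_eq_eq in P. exact P.
Qed.

Lemma S_spec r s t (x : el (Arr r (Arr s t))) (y : el (Arr r s)) (z : el r) :
  S_el M r s t • x • y • z = x • z • (y • z).
Proof.
  pose proof (HM (ax_S (v2 : tm (r :: Arr r s :: Arr r (Arr s t) :: nil) _) v1 v0)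
    (econs z (econs y (econs x (@enil _))))) as P.
  rewrite sat_eq_at, ext_eq_eq in P. exact P.
Qed.

Definition e1 s (x : el s) := econs x (@enil el).
Definition e2 s t (x : el s) (y : el t) := econs y (e1 x).
Definition e3 s t r (x : el s) (y : el t) (z : el r) := econs z (e2 x y).

Ltac axiom H :=
  let P := fresh in
  pose proof H as P; simpl in P; rewrite ?eqN_eq in P; exact P.

Lemma add_assoc (x y z : N) : x + (y + z) = x + y + z.
Proof. axiom (HM (ax_add_assoc v2 v1 v0) (e3 x y z)). Qed.
Lemma add_comm (x y : N) : x + y = y + x.
Proof. axiom (HM (ax_add_comm v1 v0) (e2 x y)). Qed.
Lemma add_0 (x : N) : x + 0 = x.
Proof. axiom (HM (ax_add_0 v0) (e1 x)). Qed.
Lemma mul_assoc (x y z : N) : x * (y * z) = x * y * z.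
Proof. axiom (HM (ax_mul_assoc v2 v1 v0) (e3 x y z)). Qed.
Lemma mul_comm (x y : N) : x * y = y * x.
Proof. axiom (HM (ax_mul_comm v1 v0) (e2 x y)). Qed.
Lemma mul_0 (x : N) : x * 0 = 0.
Proof. axiom (HM (ax_mul_0 v0) (e1 x)). Qed.
Lemma mul_1 (x : N) : x * 1 = x.
Proof. axiom (HM (ax_mul_1 v0) (e1 x)). Qed.
Lemma mul_add (x y z : N) : x * (y + z) = x * y + x * z.
Proof. axiom (HM (ax_distr v2 v1 v0) (e3 x y z)). Qed.
Lemma lt_irrefl (x : N) : ~ x < x.
Proof. axiom (HM (ax_lt_irrefl v0) (e1 x)). Qed.
Lemma lt_trans (x y z : N) : x < y -> y < z -> x < z.
Proof. axiom (HM (ax_lt_trans v2 v1 v0) (e3 x y z)). Qed.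
Lemma lt_total (x y : N) : x < y \/ x = y \/ y < x.
Proof. axiom (HM (ax_lt_total v1 v0) (e2 x y)). Qed.
Lemma lt_add (x y z : N) : x < y -> x + z < y + z.
Proof. axiom (HM (ax_lt_add v2 v1 v0) (e3 x y z)). Qed.
Lemma lt_0_1 : 0 < 1.
Proof. axiom (HM (ax_lt_0_1 nil) (@enil _)). Qed.
Lemma not_lt_0 (x : N) : ~ x < 0.
Proof. axiom (HM (ax_not_lt_0 v0) (e1 x)). Qed.
Lemma lt_succ (x y : N) : x < y + 1 -> x <= y.
Proof. axiom (HM (ax_lt_succ v1 v0) (e2 x y)). Qed.
Lemma rec_0 (f : el ty1) (m : N) : rec_el M • f • m • 0 = m.
Proof. axiom (HM (ax_rec_0 (v1 : tm (Nat :: ty1 :: nil) ty1) v0) (e2 f m)). Qed.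
Lemma rec_S (f : el ty1) (m n : N) : rec_el M • f • m • (n + 1) = f • (rec_el M • f • m • n).
Proof. axiom (HM (ax_rec_S (v2 : tm (Nat :: Nat :: ty1 :: nil) ty1) v1 v0) (e3 f m n)). Qed.

Lemma qf_induction G (A : fm (Nat :: G)) (e : envs el G) : qf A ->
  sat (econs 0 e) A -> (forall n, sat (econs n e) A -> sat (econs (n + 1) e) A) ->
  forall n, sat (econs n e) A.
Proof.
  intros HA H0 HS. pose proof (HM (ax_ind HA) e) as P.
  unfold induction_instance, inst in P. cbn [sat] in P. rewrite sat_sub in P.
  apply P.
  - replace (fun s v => eval e (scons (G := G) (r := Nat) Zero (fun _ v => Var v) (s := s) v))
      with (econs 0 e); [exact H0|]. by_var.
  - intros n Hn. rewrite sat_sub. apply HS in Hn.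
    match goal with |- sat ?e' A => replace e' with (econs (n + 1) e) end; [exact Hn|]. by_var.
Qed.

Lemma qf_choice G (A : fm (Nat :: ty1 :: G)) (e : envs el G) : qf A ->
  (forall f : el ty1, exists n : N, sat (econs n (econs f e)) A) ->
  exists Y : el ty2, forall f, sat (econs (Y • f) (econs f e)) A.
Proof.
  intros HA Hf. pose proof (HM (ax_QF_AC10 (QF_AC_intro HA)) e) as P.
  unfold ac_instance in P. cbn [sat] in P. destruct (P Hf) as [Y HY].
  exists Y. intros f. specialize (HY f). rewrite sat_sub in HY.
  match type of HY with sat ?e' A => replace (econs (Y • f) (econs f e)) with e' end;
    [exact HY|].
  apply fam_ext. apply var_case; [reflexivity|]. apply var_case; reflexivity.
Qed.

(* Combinatory definability with parameters: the tuple [p : tuple G] holds the values of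
   the variables of the context, and [lam f] is the element representing [f]. *)
Fixpoint tuple (G : ctx) : Type :=
  match G with
  | nil => unit
  | s :: G => (tuple G * el s)%type
  end.

Fixpoint curry_ty (G : ctx) (r : ty) : ty :=
  match G with
  | nil => r
  | s :: G => curry_ty G (Arr s r)
  end.

Fixpoint ap_tuple (G : ctx) (r : ty) : el (curry_ty G r) -> tuple G -> el r :=
  match G with
  | nil => fun F _ => F
  | s :: G => fun F p => ap_tuple (G := G) (r := Arr s r) F (fst p) • snd p
  end.

Definition Rep (G : ctx) (r : ty) (f : tuple G -> el r) : Prop :=
  exists F, forall p, ap_tuple F p = f p.

Definition lam (s r : ty) (f : el s -> el r) : el (Arr s r) :=
  epsilon (inhabits (eval (M := M) (@enil _) (default (Arr s r) nil)))
    (fun F => forall x, F • x = f x).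

Lemma Rep_const G r (c : el r) : Rep (fun _ : tuple G => c).
Proof.
  revert r c. induction G as [|s G IH]; intros r c.
  - now exists c.
  - destruct (IH _ (K_el M r s • c)) as [F HF]. exists F. intros p. simpl.
    rewrite HF. apply K_spec.
Qed.

(** Bracket abstraction: S distributes the most recent variable over the application, and the
    induction treats the others. *)
Lemma Rep_ap G s r (f : tuple G -> el (Arr s r)) (g : tuple G -> el s) :
  Rep f -> Rep g -> Rep (fun p => f p • g p).
Proof.
  revert s r f g. induction G as [|t G IH]; intros s r f g [F HF] [H HH].
  - exists (F • H). intros p. rewrite <- HF, <- HH. reflexivity.
  - destruct (IH _ _ (fun p => S_el M t s r • ap_tuple (G := G) F p)
      (fun p => ap_tuple (G := G) H p)) as [J HJ].
    + apply IH; [apply Rep_const | now exists F].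
    + now exists H.
    + exists J. intros p. simpl. rewrite HJ, S_spec, <- HF, <- HH. reflexivity.
Qed.

Lemma Rep_wk G s r (f : tuple G -> el r) : Rep f -> Rep (G := s :: G) (fun p => f (fst p)).
Proof.
  intros Hf. destruct (Rep_ap (Rep_const G (K_el M r s)) Hf) as [J HJ].
  exists J. intros p. simpl. rewrite HJ. apply K_spec.
Qed.

Lemma Rep_var0 G s : Rep (G := s :: G) (fun p => snd p).
Proof.
  destruct (Rep_const G (S_el M s (Arr s s) s • K_el M s (Arr s s) • K_el M s s)) as [F HF].
  exists F. intros p. simpl. rewrite HF, S_spec. apply K_spec.
Qed.
Lemma Rep_var1 G s t : Rep (G := t :: s :: G) (fun p => snd (fst p)).
Proof. exact (Rep_wk t (Rep_var0 G s)). Qed.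
Lemma Rep_var2 G s t r : Rep (G := r :: t :: s :: G) (fun p => snd (fst (fst p))).
Proof. exact (Rep_wk r (Rep_var1 G s t)). Qed.
Lemma Rep_var3 G s t r q :
  Rep (G := q :: r :: t :: s :: G) (fun p => snd (fst (fst (fst p)))).
Proof. exact (Rep_wk q (Rep_var2 G s t r)). Qed.
Lemma Rep_var4 G s t r q u :
  Rep (G := u :: q :: r :: t :: s :: G) (fun p => snd (fst (fst (fst (fst p))))).
Proof. exact (Rep_wk u (Rep_var3 G s t r q)). Qed.
Lemma Rep_var5 G s t r q u w :
  Rep (G := w :: u :: q :: r :: t :: s :: G) (fun p => snd (fst (fst (fst (fst (fst p)))))).
Proof. exact (Rep_wk w (Rep_var4 G s t r q u)). Qed.

Lemma lam_spec s r (f : el s -> el r) (F : el (Arr s r)) :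
  (forall x, F • x = f x) -> lam f = F.
Proof.
  intros HF. apply M_ext. intros x. rewrite HF. unfold lam.
  apply (epsilon_spec (inhabits _) (fun F => forall x, F • x = f x)). eauto.
Qed.

(** By extensionality the representing element is unique, so what [lam] picks for each p is the
    partial application of F to p. *)
Lemma Rep_lam G s r (f : tuple G -> el s -> el r) :
  Rep (G := s :: G) (fun p => f (fst p) (snd p)) -> Rep (fun p => lam (f p)).
Proof.
  intros [F HF]. exists F. intros p. symmetry. apply lam_spec.
  intros x. exact (HF (p, x)).
Qed.

Lemma beta s r (f : el s -> el r) (x : el s) :
  Rep (G := s :: nil) (fun p => f (snd p)) -> lam f • x = f x.
Proof.
  intros [F HF]. rewrite (@lam_spec _ _ f F); [exact (HF (tt, x))|].
  intros y. exact (HF (tt, y)).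
Qed.

Ltac rep := cbv beta; repeat first
  [ apply Rep_const | apply Rep_var0 | apply Rep_var1 | apply Rep_var2
  | apply Rep_var3 | apply Rep_var4 | apply Rep_var5
  | assumption
  | apply Rep_lam; cbv beta | apply Rep_ap ].
Ltac beta := repeat (rewrite beta by rep; cbv beta).

(* Case distinction by iterating a constant function. *)
Definition ifz_el : el (Arr Nat (Arr Nat (Arr Nat Nat))) :=
  lam (fun n => lam (fun x => lam (fun y =>
    rec_el M • (K_el M Nat Nat • y) • x • n))).
Notation ifz n x y := (ifz_el • n • x • y).

Lemma ifz_0 x y : ifz 0 x y = x.
Proof. unfold ifz_el. beta. apply rec_0. Qed.
Lemma ifz_S n x y : ifz (n + 1) x y = y.
Proof. unfold ifz_el. beta. rewrite rec_S. apply K_spec. Qed.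
Lemma add_0_l x : 0 + x = x.
Proof. rewrite add_comm. apply add_0. Qed.
Lemma ifz_1 x y : ifz 1 x y = y.
Proof. rewrite <- (add_0_l 1). apply ifz_S. Qed.

Lemma neq_0_1 : 1 <> 0.
Proof. intros E. apply (@lt_irrefl 0). rewrite <- E at 2. apply lt_0_1. Qed.

Definition pick (A : Type) (P : A -> Prop) (H : exists x, P x) : A :=
  proj1_sig (constructive_indefinite_description P H).
Lemma pick_spec (A : Type) (P : A -> Prop) (H : exists x, P x) : P (pick H).
Proof. exact (proj2_sig (constructive_indefinite_description P H)). Qed.

(** Choice applied to a case distinction: the chosen number is 0 where A holds and 1 elsewhere. *)
Lemma ex_char (A : fm (ty1 :: nil)) : qf A ->
  exists E : el ty2, forall f, E • f = 0 <-> sat (e1 f) A.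
Proof.
  intros HA.
  destruct (@qf_choice nil (Or (And (wk_fm Nat A) (Eq0 v0 Zero))
                           (And (Not (wk_fm Nat A)) (Eq0 v0 One))) (@enil el)) as [E HE].
  - assert (qf (wk_fm Nat A)) by (unfold wk_fm; rewrite ren_fm_sub_Var; now apply qf_sub).
    simpl. tauto.
  - intros f. destruct (classic (sat (e1 f) A)) as [H|H];
      [exists 0; left | exists 1; right]; unfold wk_fm; rewrite ren_fm_sub_Var;
      cbn [sat Not]; rewrite sat_sub, eqN_eq; auto.
  - exists E. intros f. specialize (HE f). revert HE. unfold wk_fm. rewrite ren_fm_sub_Var.
    cbn [sat Not]. rewrite sat_sub, !eqN_eq. cbn [eval].
    intros [[H1 H2]|[H1 H2]]; simpl in H2.
    + split; auto.
    + rewrite H2. split; [intros E0; destruct (neq_0_1 E0)|].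
      intros H. destruct (H1 H).
Qed.

Notation two x y := (lam (fun i => ifz i x y)).

(** Equality is a relation symbol without a characteristic function. Choice along type 1 supplies
    one, once x and y are packed into a single function as its values at 0 and at 1. *)
Lemma ex_eqb : exists E : el (Arr Nat (Arr Nat Nat)), forall x y, E • x • y = 0 <-> x = y.
Proof.
  destruct (@ex_char (Eq0 (App v0 Zero) (App v0 One)) I) as [E HE].
  exists (lam (fun x => lam (fun y => E • two x y))).
  intros x y. beta. rewrite HE. simpl. rewrite eqN_eq. unfold e1. simpl.
  beta. rewrite ifz_0, ifz_1. reflexivity.
Qed.

Lemma ex_ltb : exists E : el (Arr Nat (Arr Nat Nat)), forall x y, E • x • y = 0 <-> x < y.
Proof.
  destruct (@ex_char (Lt0 (App v0 Zero) (App v0 One)) I) as [E HE].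
  exists (lam (fun x => lam (fun y => E • two x y))).
  intros x y. beta. rewrite HE. simpl. unfold e1. simpl.
  beta. rewrite ifz_0, ifz_1. reflexivity.
Qed.

Definition eqb := pick ex_eqb.
Definition ltb := pick ex_ltb.
Lemma eqb_spec x y : eqb • x • y = 0 <-> x = y.
Proof. exact (pick_spec ex_eqb x y). Qed.
Lemma ltb_spec x y : ltb • x • y = 0 <-> x < y.
Proof. exact (pick_spec ex_ltb x y). Qed.

(** If x were neither 0 nor a successor, quantifier-free induction on n would show n <> x for every
    n. *)
Lemma pred_ex (x : N) : x = 0 \/ exists y, x = y + 1.
Proof.
  destruct (classic (x = 0)) as [H|H]; [auto|right]. apply NNPP. intros Hn.
  pose proof (@qf_induction (Nat :: nil) (Not (Eq0 v0 v1)) (e1 x)) as P.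
  simpl in P. setoid_rewrite eqN_eq in P. unfold e1 in P. simpl in P.
  refine (P _ _ _ x eq_refl); auto. 
  intros n _ E. apply Hn. eauto.
Qed.

Lemma ifz_neq n x y : n <> 0 -> ifz n x y = y.
Proof. destruct (pred_ex n) as [->|[m ->]]; [tauto|]. intros _. apply ifz_S. Qed.

(** These predicates take the place of quantifier-free formulas with parameters: the induction and
    choice of the model apply to them. As in the quantifier functionals, 0 means true. *)
Definition Dec (G : ctx) (P : tuple G -> Prop) : Prop :=
  exists f : tuple G -> N, Rep f /\ forall p, P p <-> f p = 0.

Lemma Dec_eq G (f g : tuple G -> N) : Rep f -> Rep g -> Dec (fun p => f p = g p).
Proof.
  intros Hf Hg. exists (fun p => eqb • f p • g p). split; [rep|].
  intros p. now rewrite eqb_spec.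
Qed.

Lemma Dec_lt G (f g : tuple G -> N) : Rep f -> Rep g -> Dec (fun p => f p < g p).
Proof.
  intros Hf Hg. exists (fun p => ltb • f p • g p). split; [rep|].
  intros p. now rewrite ltb_spec.
Qed.

Lemma Dec_not G (P : tuple G -> Prop) : Dec P -> Dec (fun p => ~ P p).
Proof.
  intros [f [Hf E]]. exists (fun p => ifz (f p) 1 0). split; [rep|].
  intros p. rewrite E. destruct (classic (f p = 0)) as [H|H].
  - rewrite H, ifz_0. split; [tauto | intros H1; destruct (neq_0_1 H1)].
  - rewrite ifz_neq by auto. tauto.
Qed.

Lemma Dec_or G (P Q : tuple G -> Prop) : Dec P -> Dec Q -> Dec (fun p => P p \/ Q p).
Proof.
  intros [f [Hf E]] [g [Hg E']]. exists (fun p => ifz (f p) 0 (g p)). split; [rep|].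
  intros p. rewrite E, E'. destruct (classic (f p = 0)) as [H|H].
  - rewrite H, ifz_0. tauto.
  - rewrite ifz_neq by auto. tauto.
Qed.

Lemma Dec_iff G (P Q : tuple G -> Prop) : (forall p, P p <-> Q p) -> Dec P -> Dec Q.
Proof. intros H [f [Hf E]]. exists f. split; auto. intros p. now rewrite <- H. Qed.

Lemma Dec_and G (P Q : tuple G -> Prop) : Dec P -> Dec Q -> Dec (fun p => P p /\ Q p).
Proof.
  intros HP HQ. apply Dec_iff with (fun p => ~ (~ P p \/ ~ Q p)).
  - intros p. tauto.
  - auto using Dec_not, Dec_or.
Qed.

Lemma Dec_imp G (P Q : tuple G -> Prop) : Dec P -> Dec Q -> Dec (fun p => P p -> Q p).
Proof.
  intros HP HQ. apply Dec_iff with (fun p => ~ P p \/ Q p).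
  - intros p. tauto.
  - auto using Dec_not, Dec_or.
Qed.

Ltac dec_step :=
  first [ assumption | apply Dec_eq; rep | apply Dec_lt; rep | apply Dec_and | apply Dec_or
        | apply Dec_not | apply Dec_imp ].
Ltac dec := cbv beta; repeat (dec_step; cbv beta).

Lemma Dec_fun G s (P : tuple G -> el s -> Prop) :
  Dec (G := s :: G) (fun p => P (fst p) (snd p)) ->
  exists h : tuple G -> el (Arr s Nat), Rep h /\ forall p x, P p x <-> h p • x = 0.
Proof.
  intros [f [[F HF] E]]. exists (ap_tuple (G := G) F). split; [now exists F|].
  intros p x. rewrite (E (p, x)), <- (HF (p, x)). reflexivity.
Qed.

Lemma Dec_el1 s (P : el s -> Prop) :
  Dec (G := s :: nil) (fun p => P (snd p)) ->
  exists F : el (Arr s Nat), forall x, P x <-> F • x = 0.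
Proof.
  intros [g [[F HF] E]]. exists F. intros x.
  pose proof (E (tt, x)) as Ek. pose proof (HF (tt, x)) as Hk.
  simpl in Ek, Hk. rewrite Ek, <- Hk. reflexivity.
Qed.

Lemma Dec_el2 s t (P : el s -> el t -> Prop) :
  Dec (G := t :: s :: nil) (fun p => P (snd (fst p)) (snd p)) ->
  exists F : el (Arr s (Arr t Nat)), forall x y, P x y <-> F • x • y = 0.
Proof.
  intros [g [[F HF] E]]. exists F. intros x y.
  pose proof (E ((tt, x), y)) as Ek. pose proof (HF ((tt, x), y)) as Hk.
  simpl in Ek, Hk. rewrite Ek, <- Hk. reflexivity.
Qed.

Lemma induction (P : N -> Prop) : Dec (G := Nat :: nil) (fun p => P (snd p)) ->
  P 0 -> (forall n, P n -> P (n + 1)) -> forall n, P n.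
Proof.
  intros HD H0 HS n. destruct (Dec_el1 HD) as [F EP].
  pose proof (@qf_induction (ty1 :: nil) (Eq0 (App v1 v0) Zero) (e1 F) I) as Q.
  simpl in Q. setoid_rewrite eqN_eq in Q. unfold e1 in Q. simpl in Q.
  setoid_rewrite EP in HS. apply EP. apply Q; auto. now apply EP.
Qed.

Lemma choice1 (P : el ty1 -> N -> Prop) :
  Dec (G := Nat :: ty1 :: nil) (fun p => P (snd (fst p)) (snd p)) ->
  (forall f, exists n, P f n) -> exists Y : el ty2, forall f, P f (Y • f).
Proof.
  intros HD HP. destruct (Dec_el2 HD) as [F EP].
  destruct (@qf_choice _ (Eq0 (App (App v2 v1) v0) Zero) (e1 F) I) as [Y HY].
  - intros f. destruct (HP f) as [n Hn]. exists n. simpl. rewrite eqN_eq.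
    now apply EP.
  - exists Y. intros f. specialize (HY f). simpl in HY. rewrite eqN_eq in HY.
    now apply EP.
Qed.

(** A number is passed to choice along type 1 as a constant function. *)
Lemma choice0 (P : N -> N -> Prop) :
  Dec (G := Nat :: Nat :: nil) (fun p => P (snd (fst p)) (snd p)) ->
  (forall m, exists n, P m n) -> exists h : el ty1, forall m, P m (h • m).
Proof.
  intros HD HP. destruct (Dec_el2 HD) as [F EP].
  destruct (@choice1 (fun f n => F • (f • 0) • n = 0)) as [Y HY].
  - dec.
  - intros f. destruct (HP (f • 0)) as [n Hn]. exists n. now apply EP.
  - exists (lam (fun m => Y • (K_el M Nat Nat • m))). intros m. beta.
    apply EP. rewrite <- (HY (K_el M Nat Nat • m)), K_spec. reflexivity.
Qed.

(** [ring] recognises binary operators, not iterated [ap]. *)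
Definition Nadd (x y : N) : N := x + y.
Definition Nmul (x y : N) : N := x * y.

Lemma N_semi_ring : semi_ring_theory (0 : N) 1 Nadd Nmul eq.
Proof.
  split; unfold Nadd, Nmul; intros.
  - apply add_0_l.
  - apply add_comm.
  - apply add_assoc.
  - rewrite mul_comm. apply mul_1.
  - rewrite mul_comm. apply mul_0.
  - apply mul_comm.
  - apply mul_assoc.
  - rewrite mul_comm, mul_add, !(mul_comm p). reflexivity.
Qed.
Add Ring N_ring : N_semi_ring.

Ltac Nring :=
  repeat change (plus_el M • ?x • ?y) with (Nadd x y);
  repeat change (times_el M • ?x • ?y) with (Nmul x y);
  ring.

(** * Order, pairing, primitive recursion and bounded quantifiers *)

Lemma lt_S x : x < x + 1.
Proof. rewrite <- (add_0_l x) at 1. rewrite (add_comm x 1). apply lt_add, lt_0_1. Qed.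
Lemma le_lt_trans x y z : x <= y -> y < z -> x < z.
Proof. intros [H| ->]; eauto using lt_trans. Qed.
Lemma lt_le_trans x y z : x < y -> y <= z -> x < z.
Proof. intros H [H1| <-]; eauto using lt_trans. Qed.
Lemma le_trans x y z : x <= y -> y <= z -> x <= z.
Proof. intros [H| ->] H1; auto. left. eauto using lt_le_trans. Qed.
Lemma lt_succ_iff x y : x < y + 1 <-> x <= y.
Proof. split; [apply lt_succ|]. intros H. apply le_lt_trans with y; auto using lt_S. Qed.
Lemma lt_not_le x y : x < y -> ~ y <= x.
Proof. intros H H1. apply (@lt_irrefl x). eauto using lt_le_trans. Qed.
Lemma not_lt_le x y : ~ x < y -> y <= x.
Proof. destruct (lt_total x y) as [H|[H|H]]; subst; tauto. Qed.
Lemma le_0 x : 0 <= x.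
Proof. apply not_lt_le, not_lt_0. Qed.
Lemma le_refl x : x <= x.
Proof. auto. Qed.

Lemma add_cancel x y z : x + z = y + z -> x = y.
Proof.
  intros E. destruct (lt_total x y) as [H|[H|H]]; auto; exfalso;
    apply (lt_add z) in H; rewrite E in H; exact (lt_irrefl H).
Qed.

Lemma le_add x d : x <= x + d.
Proof.
  destruct (le_0 d) as [H| <-].
  - left. apply (lt_add x) in H. rewrite add_0_l, add_comm in H. exact H.
  - right. now rewrite add_0.
Qed.

Lemma lt_succ_le x y : x < y -> x + 1 <= y.
Proof.
  intros H. apply not_lt_le. intros H1. apply lt_succ in H1. exact (lt_not_le H H1).
Qed.

(** If no d worked, induction would give x + d < y for all d, which fails at d = y. *)
Lemma le_ex x y : x <= y -> exists d, y = x + d.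
Proof.
  intros [H|<-]; [|exists 0; now rewrite add_0]. apply NNPP. intros Hn.
  assert (P : forall d, x + d < y).
  { apply induction.
    - dec.
    - now rewrite add_0.
    - intros d Hd. rewrite add_assoc. destruct (lt_succ_le Hd) as [H1|H1]; auto.
      destruct Hn. exists (d + 1). now rewrite add_assoc. }
  apply (@lt_not_le (x + y) y (P y)). rewrite add_comm. apply le_add.
Qed.

Lemma sqrt_ex c : exists z, z * z <= c /\ c < (z + 1) * (z + 1).
Proof.
  apply NNPP. intros Hn.
  assert (P : forall z, z * z <= c).
  { apply induction.
    - dec.
    - rewrite mul_0. apply le_0.
    - intros z Hz. apply not_lt_le. intros H. apply Hn. eauto. }
  apply (@lt_not_le c (c + 1)); [apply lt_S|].
  apply le_trans with (2 := P (c + 1)).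
  replace ((c + 1) * (c + 1)) with (c + 1 + (c * c + c)) by Nring. apply le_add.
Qed.

Lemma sqrt_unique c z w :
  z * z <= c -> c < (z + 1) * (z + 1) -> w * w <= c -> c < (w + 1) * (w + 1) -> z = w.
Proof.
  assert (P : forall z w, c < (z + 1) * (z + 1) -> w * w <= c -> ~ z < w).
  { intros z0 w0 H1 H2 H. destruct (le_ex (lt_succ_le H)) as [d ->].
    apply (lt_not_le H1). apply le_trans with (2 := H2).
    replace ((z0 + 1 + d) * (z0 + 1 + d))
      with ((z0 + 1) * (z0 + 1) + ((1 + 1) * (z0 + 1) * d + d * d)) by Nring.
    apply le_add. }
  intros H1 H2 H3 H4. destruct (lt_total z w) as [H|[H|H]]; auto; exfalso;
    [exact (P z w H2 H3 H) | exact (P w z H4 H1 H)].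
Qed.

(** The code (x + y)^2 + x lies below (x + y + 1)^2, so its integer square root is x + y and the
    remainder is x. Unlike Cantor's pairing, this involves no halving. *)
Lemma pairing_ex : exists (pair : el (Arr Nat (Arr Nat Nat))) (left right : el ty1),
  forall x y, left • (pair • x • y) = x /\ right • (pair • x • y) = y.
Proof.
  destruct (@choice0 (fun c z => z * z <= c /\ c < (z + 1) * (z + 1))) as [s Hs];
    [dec | exact sqrt_ex |].
  destruct (@choice0 (fun c x => x + s • c * (s • c) = c)) as [left Hl]; [dec| |].
  { intros c. destruct (Hs c) as [H _]. destruct (le_ex H) as [d Hd].
    exists d. rewrite add_comm. auto. }
  (* The second disjunct makes the choice total on numbers that code no pair. *)
  destruct (@choice0 (fun c y => y + left • c = s • c \/ s • c < left • c)) as [right Hr]; [dec| |].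
  { intros c. destruct (classic (s • c < left • c)) as [H|H]; [exists 0; auto|].
    destruct (le_ex (not_lt_le H)) as [d Hd]. exists d. left. rewrite add_comm. auto. }
  exists (lam (fun x => lam (fun y => (x + y) * (x + y) + x))), left, right.
  intros x y. beta.
  set (c := (x + y) * (x + y) + x).
  assert (Es : s • c = x + y).
  { destruct (Hs c) as [H1 H2]. apply (@sqrt_unique c); auto; unfold c.
    - apply le_add.
    - replace ((x + y + 1) * (x + y + 1))
        with ((x + y) * (x + y) + x + y + (x + y) + 1) by Nring.
      apply lt_succ_iff. rewrite <- !add_assoc.
      rewrite (add_assoc ((x + y) * (x + y))). apply le_add. }
  assert (El : left • c = x).
  { specialize (Hl c). rewrite Es in Hl. unfold c in Hl at 2. rewrite (add_comm _ x) in Hl.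
    exact (add_cancel Hl). }
  split; auto. destruct (Hr c) as [H|H]; rewrite Es, El in H.
  - rewrite (add_comm x y) in H. exact (add_cancel H).
  - destruct (lt_not_le H). apply le_add.
Qed.

Definition pair := pick pairing_ex.
Definition left := pick (pick_spec pairing_ex).
Definition right := pick (pick_spec (pick_spec pairing_ex)).
Lemma left_pair x y : left • (pair • x • y) = x.
Proof. apply (pick_spec (pick_spec (pick_spec pairing_ex))). Qed.
Lemma right_pair x y : right • (pair • x • y) = y.
Proof. apply (pick_spec (pick_spec (pick_spec pairing_ex))). Qed.

Definition prec_step : el (Arr (Arr Nat ty1) ty1) :=
  lam (fun h => lam (fun p => pair • (left • p + 1) • (h • (left • p) • (right • p)))).
(* Primitive recursion: the recursor only iterates, so the state carries the counter. *)
Definition prec : el (Arr (Arr Nat ty1) (Arr Nat ty1)) :=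
  lam (fun h => lam (fun m => lam (fun n =>
    right • (rec_el M • (prec_step • h) • (pair • 0 • m) • n)))).

Lemma prec_0 h m : prec • h • m • 0 = m.
Proof. unfold prec. beta. now rewrite rec_0, right_pair. Qed.

Lemma prec_S h m n : prec • h • m • (n + 1) = h • n • (prec • h • m • n).
Proof.
  unfold prec. beta. set (q := rec_el M • (prec_step • h) • (pair • 0 • m)).
  assert (E : forall k, q • (k + 1) =
      pair • (left • (q • k) + 1) • (h • (left • (q • k)) • (right • (q • k)))).
  { intros k. unfold q. rewrite rec_S. unfold prec_step at 1. now beta. }
  assert (P : forall n, left • (q • n) = n).
  { apply induction; [dec| |].
    - unfold q. rewrite rec_0. apply left_pair.
    - intros k Hk. now rewrite E, left_pair, Hk. }
  now rewrite E, right_pair, P.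
Qed.

Definition ball : el (Arr ty1 ty1) :=
  lam (fun f => lam (fun n => prec • lam (fun i => lam (fun b => ifz b (f • i) 1)) • 0 • n)).

Lemma ball_spec f n : ball • f • n = 0 <-> forall i, i < n -> f • i = 0.
Proof.
  assert (E0 : ball • f • 0 = 0) by (unfold ball; beta; apply prec_0).
  assert (ES : forall n, ball • f • (n + 1) = 0 <-> ball • f • n = 0 /\ f • n = 0).
  { intros k. unfold ball. beta. rewrite prec_S. beta.
    match goal with |- context [ifz ?b _ _] => destruct (classic (b = 0)) as [H|H];
      [rewrite H, ifz_0; tauto | rewrite ifz_neq by auto] end.
    split; [intros H1; destruct (neq_0_1 H1) | tauto]. }
  split.
  - intros H i Hi. revert n H Hi.
    apply (@induction (fun n => ball • f • n = 0 -> i < n -> f • i = 0)); [dec| |].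
    + intros _ H. destruct (not_lt_0 H).
    + intros n IH H Hi. apply ES in H. destruct H as [H1 H2].
      apply lt_succ in Hi. destruct Hi as [Hi| ->]; auto.
  - intros H. assert (P : forall k, k <= n -> ball • f • k = 0).
    { apply (@induction (fun k => k <= n -> ball • f • k = 0)); [dec|auto|].
      intros k IH Hk. assert (k < n) by (apply lt_le_trans with (k + 1); auto using lt_S).
      apply ES. auto. }
    auto.
Qed.

Lemma Dec_ball G (t : tuple G -> N) (P : tuple G -> N -> Prop) :
  Rep t -> Dec (G := Nat :: G) (fun p => P (fst p) (snd p)) ->
  Dec (fun p => forall i, i < t p -> P p i).
Proof.
  intros Ht HP. destruct (Dec_fun HP) as [h [Hh E]].
  exists (fun p => ball • h p • t p). split; [rep|].
  intros p. rewrite ball_spec. split; intros H i Hi; apply E; auto.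
Qed.

Ltac dec_step ::= first [ assumption | apply Dec_eq; rep | apply Dec_lt; rep
  | apply Dec_and | apply Dec_or | apply Dec_not | apply Dec_ball; [rep|] | apply Dec_imp ].

Lemma least (P : N -> Prop) : Dec (G := Nat :: nil) (fun p => P (snd p)) ->
  (exists n, P n) -> exists n, P n /\ forall i, i < n -> ~ P i.
Proof.
  intros HD [n Hn]. apply NNPP. intros Hl. destruct (Dec_el1 HD) as [F EP].
  assert (H : forall k i, i < k -> ~ F • i = 0).
  { apply (@induction (fun k => forall i, i < k -> ~ F • i = 0)); [dec| |].
    - intros i Hi. destruct (not_lt_0 Hi).
    - intros k IH i Hi HP. apply lt_succ in Hi. destruct Hi as [Hi| ->]; [exact (IH i Hi HP)|].
      apply Hl. exists k. split; [now apply EP|]. intros i Hi. rewrite EP. auto. }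
  apply (H (n + 1) n (lt_S n)). now apply EP.
Qed.

(** * Continuity and quantifiers *)

Notation agree f g n := (forall i, i < n -> f • i = g • i).

(* The number c codes the infinite sequence left c, left (right c), left (right (right c)), ... *)
Definition seq_of : el (Arr Nat ty1) := lam (fun c => lam (fun i => left • (rec_el M • right • c • i))).

Lemma seq_of_0 a c : seq_of • (pair • a • c) • 0 = a.
Proof. unfold seq_of. beta. now rewrite rec_0, left_pair. Qed.

Lemma seq_of_S a c i : seq_of • (pair • a • c) • (i + 1) = seq_of • c • i.
Proof.
  assert (P : forall i, rec_el M • right • (pair • a • c) • (i + 1) = rec_el M • right • c • i).
  { apply induction; [dec| |].
    - now rewrite rec_S, !rec_0, right_pair.
    - intros k Hk. now rewrite rec_S, Hk, rec_S. }
  unfold seq_of. beta. now rewrite P.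
Qed.

Lemma seq_of_dense (g : el ty1) n : exists c, agree (seq_of • c) g n.
Proof.
  (* d maps k to n - k for k <= n. *)
  destruct (@choice0 (fun k j => k + j = n \/ n < k)) as [d Hd]; [dec| |].
  { intros k. destruct (classic (n < k)) as [H|H]; [exists 0; auto|].
    destruct (le_ex (not_lt_le H)) as [j Hj]. exists j. auto. }
  (* Pairing prepends, so the code grows backwards: [r • k] codes the segment of g from n - k to n -
     1. *)
  pose (r := prec • lam (fun k => lam (fun e => pair • (g • (d • (k + 1))) • e)) • 0).
  assert (rS : forall k, r • (k + 1) = pair • (g • (d • (k + 1))) • (r • k)).
  { intros k. unfold r. rewrite prec_S. now beta. }
  assert (Hd' : forall k, k <= n -> k + d • k = n).
  { intros k Hk. destruct (Hd k) as [H|H]; auto. destruct (lt_not_le H Hk). }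
  assert (P : forall k, k <= n -> agree (seq_of • (r • k)) (lam (fun i => g • (d • k + i))) k).
  { apply (@induction (fun k => k <= n ->
      forall i, i < k -> seq_of • (r • k) • i = lam (fun i => g • (d • k + i)) • i)); [dec| |].
    - intros _ i Hi. destruct (not_lt_0 Hi).
    - intros k IH Hk i Hi. beta. rewrite rS.
      assert (Hk' : k <= n) by (apply le_trans with (k + 1); auto using le_add).
      destruct (pred_ex i) as [->|[j ->]].
      + now rewrite seq_of_0, add_0.
      + rewrite seq_of_S, IH; auto.
        * beta. f_equal. apply (@add_cancel _ _ k).
          replace (d • k + j + k) with (k + d • k + j) by Nring.
          replace (d • (k + 1) + (j + 1) + k) with (k + 1 + d • (k + 1) + j) by Nring.
          now rewrite !Hd'.
        * apply lt_succ in Hi. destruct Hi as [Hi| <-]; [|apply lt_S].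
          apply lt_trans with (j + 1); auto using lt_S. }
  exists (r • n). intros i Hi. rewrite P; auto. beta. f_equal.
  specialize (Hd' n (le_refl n)).
  assert (E : d • n = 0).
  { apply (@add_cancel _ _ n). rewrite add_0_l, add_comm. exact Hd'. }
  now rewrite E, add_0_l.
Qed.

Definition splice : el (Arr ty1 (Arr ty1 (Arr Nat ty1))) :=
  lam (fun g => lam (fun f => lam (fun n => lam (fun i => ifz (ltb • i • n) (g • i) (f • i))))).

Lemma splice_lt g f n i : i < n -> splice • g • f • n • i = g • i.
Proof. intros H. unfold splice. beta. apply ltb_spec in H. now rewrite H, ifz_0. Qed.

Lemma splice_ge g f n i : ~ i < n -> splice • g • f • n • i = f • i.
Proof. intros H. unfold splice. beta. rewrite <- ltb_spec in H. now rewrite ifz_neq. Qed.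

Definition continuous (Y : el ty2) : Prop :=
  forall f, exists n, forall g, agree f g n -> Y • f = Y • g.

Definition quantifier (s : ty) (Q : el (Arr (Arr s Nat) Nat)) : Prop :=
  (forall Y, Q • Y <= 1) /\ forall Y, (exists x, Y • x = 0) <-> Q • Y = 0.

Notation jump := (@quantifier Nat).

(* Grilliot's trick: a functional jumping along the sequence G n -> h recognises zeros of x,
   by evaluating it at h with the tail switched to G n as soon as a zero x n = 0 is seen. *)
Lemma grilliot (Y : el ty2) (h : el ty1) (G : el (Arr Nat ty1)) :
  (forall n, agree (G • n) h n /\ Y • (G • n) <> Y • h) -> exists phi, jump phi.
Proof.
  intros HG.
  (* [l • x • k] counts up with k until it meets a zero of x, and then stays at that zero. *)
  pose (l := lam (fun x : el ty1 =>
    rec_el M • lam (fun m => ifz (x • m) m (m + 1)) • 0)).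
  (* The index i + 1 matters: G n is known to agree with h only below n, so entry i has to be taken
     from G at i + 1 or later as long as no zero has appeared. *)
  pose (F := lam (fun x => lam (fun i => G • (l • x • (i + 1)) • i))).
  assert (l0 : forall x, l • x • 0 = 0).
  { intros x. unfold l. beta. apply rec_0. }
  assert (lS : forall x n, l • x • (n + 1) = ifz (x • (l • x • n)) (l • x • n) (l • x • n + 1)).
  { intros x n. unfold l. beta. rewrite rec_S. now beta. }
  (* The premise says that x has no zero below n: replacing zeros by ones changes nothing there. *)
  assert (lid : forall x n, agree x (lam (fun i => ifz (x • i) 1 (x • i))) n ->
    forall k, k <= n -> l • x • k = k).
  { intros x n Hx. apply (@induction (fun k => k <= n -> l • x • k = k)); [dec|auto|].
    intros k IH Hk. assert (Hk' : k < n) by (apply lt_le_trans with (k + 1); auto using lt_S).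
    rewrite lS, IH by auto. apply ifz_neq. intros E. specialize (Hx k Hk').
    revert Hx. beta. rewrite E, ifz_0. intros E'. exact (neq_0_1 (eq_sym E')). }
  assert (lid' : forall x n, (forall i, i < n -> x • i <> 0) -> forall k, k <= n -> l • x • k = k).
  { intros x n Hx. apply lid. intros i Hi. beta. now rewrite ifz_neq by auto. }
  assert (F_nozero : forall x, (forall n, x • n <> 0) -> F • x = h).
  { intros x Hx. apply M_ext. intros i. unfold F. beta.
    rewrite (@lid' x (i + 1)) by auto. apply HG, lt_S. }
  assert (F_zero : forall x, (exists n, x • n = 0) -> exists n, F • x = G • n).
  { intros x Hx. destruct (@least (fun n => x • n = 0)) as [n [Hn Hl]]; [dec|exact Hx|].
    exists n. apply M_ext. intros i. unfold F. beta.
    destruct (classic (i < n)) as [H|H].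
    - rewrite (@lid' x n) by auto using lt_succ_le.
      destruct (HG (i + 1)) as [E _]. rewrite E by apply lt_S.
      destruct (HG n) as [E' _]. now rewrite E'.
    - apply not_lt_le in H. destruct (le_ex H) as [d ->].
      assert (P : forall d, l • x • (n + d) = n).
      { apply induction; [dec| |].
        - rewrite add_0. apply (@lid' x n); auto.
        - intros e He. now rewrite add_assoc, lS, He, Hn, ifz_0. }
      now rewrite <- add_assoc, P. }
  exists (lam (fun x => ifz (eqb • (Y • (F • x)) • (Y • h)) 1 0)).
  assert (Hphi : forall x, (exists n, x • n = 0) <-> Y • (F • x) <> Y • h).
  { intros x. split.
    - intros Hx. destruct (F_zero x Hx) as [n ->]. apply HG.
    - intros H. apply NNPP. intros Hn. apply H. rewrite F_nozero; auto.
      intros n E. apply Hn. eauto. }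
  split; intros x; beta; rewrite ?Hphi;
    destruct (classic (Y • (F • x) = Y • h)) as [E|E].
  - rewrite (proj2 (eqb_spec _ _) E), ifz_0. auto.
  - rewrite ifz_neq by now rewrite eqb_spec. left. apply lt_0_1.
  - rewrite (proj2 (eqb_spec _ _) E), ifz_0. split; [tauto|]. intros E'. destruct (neq_0_1 E').
  - rewrite ifz_neq by now rewrite eqb_spec. tauto.
Qed.

(* If f has finite modifications arbitrarily close to f with another value, choosing their
   codes gives a sequence as in [grilliot]. Otherwise Y is constant on the finite
   modifications of f near f, and takes another value at some g near f, which is the limit
   of such modifications. *)
Lemma jump_of_discontinuous (Y : el ty2) : ~ continuous Y -> exists phi, jump phi.
Proof.
  intros HY. apply not_all_ex_not in HY. destruct HY as [f Hf].
  assert (Hdisc : forall n, exists g, agree f g n /\ Y • f <> Y • g).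
  { intros n. apply NNPP. intros H. apply Hf. exists n. intros g Hg.
    apply NNPP. intros H1. apply H. eauto. }
  (* All finite modifications of f, enumerated by numbers: c gives a length and a code for the
     values below that length. *)
  pose (w := lam (fun c => splice • (seq_of • (right • c)) • f • (left • c))).
  destruct (classic (forall n, exists c, agree (w • c) f n /\ Y • (w • c) <> Y • f)) as [H|H].
  - destruct (@choice0 (fun n c => agree (w • c) f n /\ Y • (w • c) <> Y • f)) as [h Hh];
      [dec|exact H|].
    apply (@grilliot Y f (lam (fun n => w • (h • n)))).
    intros n. beta. apply Hh.
  - apply not_all_ex_not in H. destruct H as [n0 H].
    destruct (Hdisc n0) as [g [Hg HYg]].
    apply (@grilliot Y g (lam (fun n => splice • g • f • n))).
    intros n. beta. split; [intros i; apply splice_lt|].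
    destruct (seq_of_dense g n) as [c Hc].
    assert (E : w • (pair • n • c) = splice • g • f • n).
    { apply M_ext. intros i. unfold w. beta. rewrite left_pair, right_pair.
      destruct (classic (i < n)) as [Hi|Hi].
      - rewrite !splice_lt by auto. auto.
      - now rewrite !splice_ge. }
    intros E'. apply H. exists (pair • n • c). rewrite E. split.
    + intros i Hi. destruct (classic (i < n)) as [Hi'|Hi'].
      * rewrite splice_lt by auto. symmetry. auto.
      * now rewrite splice_ge.
    + rewrite E'. auto.
Qed.

(** * Uniform continuity on binary functions *)

Definition binary (f : el ty1) : Prop := forall i, f • i <= 1.

Lemma le_1 x : x <= 1 -> x = 0 \/ x = 1.
Proof.
  intros [H|H]; auto. left. rewrite <- (add_0_l 1) in H. apply lt_succ in H.
  destruct H as [H|H]; auto. destruct (not_lt_0 H).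
Qed.

(** The jump itself is the counterexample: the function 1 1 1 ... and its change to 0 at the single
    argument [Omega • phi] agree below the modulus, but phi separates them. *)
Lemma jump_not_uniform phi (Omega : el ty3) : jump phi ->
  ~ (forall Y f, binary f -> forall g, binary g -> agree f g (Omega • Y) -> Y • f = Y • g).
Proof.
  intros [_ Hphi] H.
  pose (f := lam (fun i : N => 1)).
  pose (g := lam (fun i => ifz (eqb • i • (Omega • phi)) 0 1)).
  assert (Hf : forall i, f • i = 1) by (intros i; unfold f; now beta).
  assert (Hg : forall i, g • i = ifz (eqb • i • (Omega • phi)) 0 1).
  { intros i. unfold g. now beta. }
  assert (E : phi • f = phi • g).
  { apply H.
    - intros i. rewrite Hf. auto.
    - intros i. rewrite Hg. destruct (classic (eqb • i • (Omega • phi) = 0)) as [E|E].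
      + rewrite E, ifz_0. apply le_0.
      + rewrite ifz_neq by auto. auto.
    - intros i Hi. rewrite Hf, Hg, ifz_neq; auto. rewrite eqb_spec. intros ->.
      exact (lt_irrefl Hi). }
  assert (Eg : phi • g = 0).
  { apply Hphi. exists (Omega • phi). rewrite Hg.
    rewrite (proj2 (eqb_spec _ _) eq_refl). apply ifz_0. }
  rewrite Eg in E. apply Hphi in E. destruct E as [n E]. rewrite Hf in E.
  exact (neq_0_1 E).
Qed.

(** With Q the jump, all arithmetical predicates become available for induction and choice. *)
Lemma Dec_ex s (Q : el (Arr (Arr s Nat) Nat)) G (P : tuple G -> el s -> Prop) :
  quantifier Q -> Dec (G := s :: G) (fun p => P (fst p) (snd p)) ->
  Dec (fun p => exists x, P p x).
Proof.
  intros [_ HQ] HP. destruct (Dec_fun HP) as [h [Hh E]].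
  exists (fun p => Q • h p). split; [rep|].
  intros p. rewrite <- HQ. split; intros [x Hx]; exists x; now apply E.
Qed.

Lemma Dec_all s (Q : el (Arr (Arr s Nat) Nat)) G (P : tuple G -> el s -> Prop) :
  quantifier Q -> Dec (G := s :: G) (fun p => P (fst p) (snd p)) ->
  Dec (fun p => forall x, P p x).
Proof.
  intros HQ HP. apply Dec_iff with (fun p => ~ exists x, ~ P p x).
  - intros p. split; [intros H x; apply NNPP; eauto | intros H [x Hx]; auto].
  - apply Dec_not, (Dec_ex HQ), Dec_not, HP.
Qed.

Ltac dec_step ::= first [ assumption | apply Dec_eq; rep | apply Dec_lt; rep
  | apply Dec_and | apply Dec_or | apply Dec_not | apply Dec_ball; [rep|] | apply Dec_imp
  | eapply Dec_ex; [eassumption|] | eapply Dec_all; [eassumption|] ].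

Definition bin : el (Arr Nat ty1) := lam (fun c => lam (fun i => ifz (seq_of • c • i) 0 1)).

Lemma bin_spec c i : bin • c • i = ifz (seq_of • c • i) 0 1.
Proof. unfold bin. now beta. Qed.

Lemma bin_binary c : binary (bin • c).
Proof.
  intros i. rewrite bin_spec. destruct (classic (seq_of • c • i = 0)) as [E|E].
  - rewrite E, ifz_0. apply le_0.
  - rewrite ifz_neq; auto.
Qed.

Lemma bin_dense g n : binary g -> exists c, agree (bin • c) g n.
Proof.
  intros Hg. destruct (seq_of_dense g n) as [c Hc]. exists c. intros i Hi.
  rewrite bin_spec, Hc by auto.
  destruct (le_1 (Hg i)) as [E|E]; rewrite E; [apply ifz_0 | apply ifz_1].
Qed.

Lemma bin_agree_S f g k : binary f -> binary g -> agree f g k ->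
  f • k = g • k -> agree f g (k + 1).
Proof.
  intros Hf Hg H E i Hi. apply lt_succ in Hi. destruct Hi as [Hi| ->]; auto.
Qed.

Section Compactness.
Variable phi : el ty2.
Hypothesis Hphi : jump phi.
Variable Y : el ty2.
Hypothesis HY : continuous Y.

(** The node is the initial segment of [bin • e] of length k, and Y is asked to be uniformly
    continuous on the coded sequences through it. Quantifying over codes and not over functions
    keeps this arithmetical in Y, hence decidable from phi. *)
Let good (k e : N) : Prop := exists n, forall c d,
  agree (bin • c) (bin • e) k -> agree (bin • d) (bin • e) k ->
  agree (bin • c) (bin • d) n -> Y • (bin • c) = Y • (bin • d).

(** If both one-step extensions of the node were good, their moduli would combine into one for the
    node. *)
Lemma bad_extends k e : ~ good k e ->
  exists e', agree (bin • e') (bin • e) k /\ ~ good (k + 1) e'.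
Proof.
  intros Hbad. apply NNPP. intros Hn. apply Hbad.
  assert (H : forall v, v <= 1 -> exists e' n, agree (bin • e') (bin • e) k /\ bin • e' • k = v /\
    forall c d, agree (bin • c) (bin • e') (k + 1) -> agree (bin • d) (bin • e') (k + 1) ->
      agree (bin • c) (bin • d) n -> Y • (bin • c) = Y • (bin • d)).
  { intros v Hv.
    pose (s := splice • (bin • e) • (K_el M Nat Nat • v) • k).
    destruct (@bin_dense s (k + 1)) as [e' He'].
    { intros i. unfold s. destruct (classic (i < k)) as [Hi|Hi].
      - rewrite splice_lt by auto. apply bin_binary.
      - rewrite splice_ge by auto. now rewrite K_spec. }
    assert (H1 : agree (bin • e') (bin • e) k).
    { intros i Hi. rewrite He'; [now apply splice_lt|]. apply lt_succ_iff. auto. }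
    assert (H2 : bin • e' • k = v).
    { rewrite He' by apply lt_S. unfold s. rewrite splice_ge by apply lt_irrefl. apply K_spec. }
    destruct (classic (good (k + 1) e')) as [[n Hg]|Hg]; [eauto 6|].
    destruct Hn. eauto. }
  destruct (H 0 (le_0 _)) as [e0 [n0 [A0 [V0 G0]]]].
  destruct (H 1 (le_refl _)) as [e1 [n1 [A1 [V1 G1]]]].
  (* The summand k + 1 forces c and d to agree at k, so that both pass through the same
     extension. *)
  exists (n0 + n1 + (k + 1)). intros c d Hc Hd Hcd.
  assert (Hk : bin • c • k = bin • d • k).
  { apply Hcd. rewrite add_comm. apply lt_le_trans with (k + 1); [apply lt_S | apply le_add]. }
  assert (Hn0 : agree (bin • c) (bin • d) n0).
  { intros i Hi. apply Hcd. apply lt_le_trans with (1 := Hi). rewrite <- add_assoc. apply le_add. }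
  assert (Hn1 : agree (bin • c) (bin • d) n1).
  { intros i Hi. apply Hcd. apply lt_le_trans with (1 := Hi).
    replace (n0 + n1 + (k + 1)) with (n1 + (n0 + (k + 1))) by Nring. apply le_add. }
  destruct (le_1 (bin_binary c k)) as [E|E].
  - apply G0; auto; apply bin_agree_S; try apply bin_binary; try congruence;
      intros i Hi; [rewrite Hc | rewrite Hd]; auto; symmetry; auto.
  - apply G1; auto; apply bin_agree_S; try apply bin_binary; try congruence;
      intros i Hi; [rewrite Hc | rewrite Hd]; auto; symmetry; auto.
Qed.

Lemma root_good : good 0 0.
Proof.
  apply NNPP. intros Hroot.
  (* Guarding by badness makes the choice total; the predicate is arithmetical, so the jump decides
     it. *)
  destruct (@choice0 (fun p e' => ~ good (left • p) (right • p) ->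
    agree (bin • e') (bin • (right • p)) (left • p) /\ ~ good (left • p + 1) e')) as [h Hh].
  { unfold good. dec. }
  { intros p. destruct (classic (good (left • p) (right • p))) as [H|H].
    - exists 0. tauto.
    - destruct (bad_extends H) as [e' He']. eauto. }
  pose (q := prec • lam (fun k => lam (fun e => h • (pair • k • e))) • 0).
  assert (qS : forall k, q • (k + 1) = h • (pair • k • (q • k))).
  { intros k. unfold q. rewrite prec_S. now beta. }
  assert (Hh' : forall k e, ~ good k e -> agree (bin • (h • (pair • k • e))) (bin • e) k /\
    ~ good (k + 1) (h • (pair • k • e))).
  { intros k e. specialize (Hh (pair • k • e)). rewrite left_pair, right_pair in Hh. exact Hh. }
  assert (Hbad : forall k, ~ good k (q • k)).
  { apply (@induction (fun k => ~ good k (q • k))).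
    - unfold good. dec.
    - unfold q. now rewrite prec_0.
    - intros k Hk. rewrite qS. now apply Hh'. }
  (* Entry i is settled from level i + 1 on, so f is the limit of the path of bad nodes. *)
  pose (f := lam (fun i => bin • (q • (i + 1)) • i)).
  assert (Hf : forall k, agree (bin • (q • k)) f k).
  { apply (@induction (fun k => forall i, i < k -> bin • (q • k) • i = f • i)); [dec| |].
    - intros i Hi. destruct (not_lt_0 Hi).
    - intros k IH i Hi. apply lt_succ in Hi. destruct Hi as [Hi| ->].
      + rewrite <- IH by auto. rewrite qS. now apply Hh'.
      + unfold f. now beta. }
  (* Through the node of level n, Y takes the constant value Y f on coded sequences, so that node is
     good with modulus 0. *)
  destruct (HY f) as [n Hn]. apply (Hbad n). exists 0. intros c d Hc Hd _.
  rewrite <- (Hn (bin • c)), <- (Hn (bin • d)); auto;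
    intros i Hi; [rewrite Hd | rewrite Hc]; auto; symmetry; auto.
Qed.
End Compactness.

Lemma fan_of_jump phi : jump phi -> exists Phi : el ty3, forall Y, continuous Y ->
  forall f, binary f -> forall g, binary g -> agree f g (Phi • Y) -> Y • f = Y • g.
Proof.
  intros Hphi.
  (* The jump only tells whether f has a zero; choice along type 1 turns it into a search operator,
     with value 0 allowed when there is none. *)
  destruct (@choice1 (fun f n => phi • f = 0 -> f • n = 0)) as [mu Hmu]; [dec| |].
  { intros f. destruct (classic (phi • f = 0)) as [H|H]; [|exists 0; tauto].
    pose proof (proj2 (proj2 Hphi f) H) as [n Hn]. eauto. }
  (* Being a modulus on the dense set is arithmetical in Y, so F turns Y into a function whose zeros
     are its moduli there. *)
  destruct (@Dec_el2 ty2 Nat (fun Y n => forall c d, agree (bin • c) (bin • d) n ->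
    Y • (bin • c) = Y • (bin • d))) as [F HF]; [dec|].
  exists (lam (fun Y => mu • (F • Y))). intros Y HY f Hf g Hg. beta. intros Hfg.
  assert (Hmod : F • Y • (mu • (F • Y)) = 0).
  { apply Hmu, (proj2 Hphi). destruct (root_good Hphi HY) as [n Hn].
    exists n. apply HF. intros c d. apply Hn; intros i Hi; destruct (not_lt_0 Hi). }
  rewrite <- HF in Hmod. set (m := mu • (F • Y)) in *.
  destruct (HY f) as [n1 H1], (HY g) as [n2 H2].
  (* The approximations are so close that Y does not change between f and c or between g and d, and
     that c and d still agree below m. *)
  destruct (bin_dense (n1 + n2 + m) Hf) as [c Hc], (bin_dense (n1 + n2 + m) Hg) as [d Hd].
  assert (L1 : forall i, i < n1 -> i < n1 + n2 + m).
  { intros i Hi. apply lt_le_trans with (1 := Hi). rewrite <- add_assoc. apply le_add. }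
  assert (L2 : forall i, i < n2 -> i < n1 + n2 + m).
  { intros i Hi. apply lt_le_trans with (1 := Hi).
    replace (n1 + n2 + m) with (n2 + (n1 + m)) by Nring. apply le_add. }
  assert (L3 : forall i, i < m -> i < n1 + n2 + m).
  { intros i Hi. apply lt_le_trans with (1 := Hi). rewrite add_comm. apply le_add. }
  rewrite (H1 (bin • c)), (H2 (bin • d)).
  - apply Hmod. intros i Hi. rewrite Hc, Hd; auto.
  - intros i Hi. symmetry. auto.
  - intros i Hi. symmetry. auto.
Qed.

Lemma jump_of_quantifier1 (E : el ty3) : quantifier (s := ty1) E -> exists phi, jump phi.
Proof.
  intros [H1 H2]. exists (lam (fun f => E • lam (fun g => f • (g • 0)))).
  split; intros f; beta; [apply H1|]. rewrite <- H2. split.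
  - intros [n Hn]. exists (K_el M Nat Nat • n). beta. now rewrite K_spec.
  - intros [g Hg]. revert Hg. beta. eauto.
Qed.

Lemma Z_of_quantifier1 (E : el ty3) : quantifier (s := ty1) E ->
  exists Z : el ty3, forall Y, Z • Y = 0 <-> continuous Y.
Proof.
  intros HE. destruct (jump_of_quantifier1 HE) as [phi Hphi].
  destruct (@Dec_el1 ty2 continuous) as [Z HZ].
  - unfold continuous. dec.
  - exists Z. intros Y. now rewrite HZ.
Qed.

Lemma Z_of_not_jump : ~ (exists phi, jump phi) ->
  exists Z : el ty3, forall Y, Z • Y = 0 <-> continuous Y.
Proof.
  intros H. exists (K_el M Nat ty2 • 0). intros Y. rewrite K_spec. split; auto.
  intros _. apply NNPP. intros HY. exact (H (jump_of_discontinuous HY)).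
Qed.

(* Y has a zero iff (x, f) |-> [Y f = 0 and x has a zero] is discontinuous: if Y f = 0, it
   jumps at (1 1 1 ..., f). *)
Lemma quantifier1_of_Z phi (Z : el ty3) : jump phi ->
  (forall Y, Z • Y = 0 <-> continuous Y) -> exists E : el ty3, quantifier (s := ty1) E.
Proof.
  intros Hphi HZ.
  (* The single function h codes a pair of functions entry by entry, x by the left components and f
     by the right ones. *)
  pose (T := lam (fun Y : el ty2 => lam (fun h : el ty1 =>
    ifz (Y • lam (fun i => right • (h • i))) (phi • lam (fun i => left • (h • i))) 1))).
  assert (HT : forall Y h, T • Y • h =
    ifz (Y • lam (fun i => right • (h • i))) (phi • lam (fun i => left • (h • i))) 1).
  { intros Y h. unfold T. now beta. }
  assert (H : forall Y : el ty2, (exists f, Y • f = 0) <-> ~ continuous (T • Y)).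
  { intros Y. split.
    - intros [f Hf] HC.
      pose (w := fun x : el ty1 => lam (fun i => pair • (x • i) • (f • i))).
      assert (Hw : forall x, T • Y • w x = phi • x).
      { intros x. rewrite HT.
        replace (lam (fun i => right • (w x • i))) with f.
        - rewrite Hf, ifz_0. f_equal. apply lam_spec. intros i. unfold w. beta.
          now rewrite left_pair.
        - symmetry. apply lam_spec. intros i. unfold w. beta. now rewrite right_pair. }
      pose (ones := K_el M Nat Nat • 1).
      destruct (HC (w ones)) as [n Hn].
      (* With its only zero at n, x agrees with [ones] below n but has another value under phi. *)
      pose (x := lam (fun i => ifz (eqb • i • n) 0 1)).
      assert (Hx : forall i, x • i = ifz (eqb • i • n) 0 1) by (intros i; unfold x; now beta).
      specialize (Hn (w x)). rewrite !Hw in Hn.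
      assert (E : phi • x = 0).
      { apply (proj2 Hphi). exists n. rewrite Hx, (proj2 (eqb_spec _ _) eq_refl). apply ifz_0. }
      rewrite E in Hn.
      destruct (proj2 (proj2 Hphi ones)) as [m Hm].
      + apply Hn. intros i Hi. unfold w. beta. f_equal. f_equal.
        rewrite Hx, ifz_neq; [apply K_spec|].
        rewrite eqb_spec. intros ->. exact (lt_irrefl Hi).
      + unfold ones in Hm. rewrite K_spec in Hm. exact (neq_0_1 Hm).
    (* If Y has no zero, [T • Y] is constantly 1. *)
    - intros H. apply NNPP. intros Hn. apply H. intros f. exists 0. intros g _.
      rewrite !HT, !ifz_neq; auto; intros E; apply Hn; eauto. }
  exists (lam (fun Y => ifz (Z • (T • Y)) 1 0)).
  split; intros Y; beta; rewrite ?H, <- ?HZ;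
    destruct (classic (Z • (T • Y) = 0)) as [E|E].
  - rewrite E, ifz_0. auto.
  - rewrite ifz_neq by auto. apply le_0.
  - rewrite E, ifz_0. split; [tauto|]. intros E'. destruct (neq_0_1 E').
  - rewrite ifz_neq by auto. tauto.
Qed.

(** * The sentences of the theorem in a model *)

Notation sat0 := (sat (M := M) (@enil el)).

Lemma sat_Exists2 : sat0 Exists2 <-> exists phi, jump phi.
Proof.
  unfold quantifier. simpl. setoid_rewrite eqN_eq. setoid_rewrite K_spec. split; intros [phi [H1 H2]]; exists phi;
    split; auto; intros Y; specialize (H2 Y); simpl in *; tauto.
Qed.

Lemma sat_Exists3 : sat0 Exists3 <-> exists E : el ty3, quantifier (s := ty1) E.
Proof.
  unfold quantifier. simpl. setoid_rewrite eqN_eq. setoid_rewrite K_spec. split; intros [phi [H1 H2]]; exists phi;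
    split; auto; intros Y; specialize (H2 Y); simpl in *; tauto.
Qed.

Lemma sat_Z3 : sat0 Z3 <-> exists Z : el ty3, forall Y, Z • Y = 0 <-> continuous Y.
Proof.
  unfold continuous. simpl. setoid_rewrite eqN_eq. split; intros [Z HZ]; exists Z;
    intros Y; specialize (HZ Y); simpl in *; tauto.
Qed.

Lemma sat_MUC : sat0 MUC <-> exists Omega : el ty3, forall Y,
  forall f, binary f -> forall g, binary g -> agree f g (Omega • Y) -> Y • f = Y • g.
Proof. unfold binary. simpl. setoid_rewrite eqN_eq. setoid_rewrite K_spec. reflexivity. Qed.

Lemma sat_FF : sat0 FF <-> exists Phi : el ty3, forall Y, continuous Y ->
  forall f, binary f -> forall g, binary g -> agree f g (Phi • Y) -> Y • f = Y • g.
Proof. unfold binary, continuous. simpl. setoid_rewrite eqN_eq. setoid_rewrite K_spec. reflexivity. Qed.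

Lemma Exists2_FF_not_MUC : sat0 Exists2 <-> sat0 FF /\ ~ sat0 MUC.
Proof.
  rewrite sat_Exists2, sat_FF, sat_MUC. split.
  - intros [phi Hphi]. split; [exact (fan_of_jump Hphi)|].
    intros [Omega HO]. exact (jump_not_uniform Hphi HO).
  - intros [[Phi HPhi] HM']. apply NNPP. intros Hn. apply HM'. exists Phi.
    intros Y. apply HPhi. apply NNPP. intros HY. exact (Hn (jump_of_discontinuous HY)).
Qed.

Lemma Exists3_Exists2_Z3 : sat0 Exists3 <-> sat0 Exists2 /\ sat0 Z3.
Proof.
  rewrite sat_Exists2, sat_Exists3, sat_Z3. split.
  - intros [E HE]. split; [exact (jump_of_quantifier1 HE) | exact (Z_of_quantifier1 HE)].
  - intros [[phi Hphi] [Z HZ]]. exact (quantifier1_of_Z Hphi HZ).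
Qed.

Lemma not_Exists2_Z3 : ~ sat0 Exists2 -> sat0 Z3.
Proof. rewrite sat_Exists2, sat_Z3. apply Z_of_not_jump. Qed.

End Model.

Lemma RCA0w_QFAC20_complete (A : fm nil) :
  (forall M, models M RCA0w -> standard_eq M -> extensional M -> sat (M := M) (@enil _) A) ->
  proves RCA0w_QFAC20 A.
Proof.
  intros HA. apply completeness.
  - apply sub_closed_RCA0w_QFAC20.
  - intros. apply add_left. constructor.
  - intros M HM. apply HA. intros G B HB. apply HM. now apply add_left.
Qed.

Theorem theorem3p7 :
  proves RCA0w_QFAC20 (Exists2 ⇔ (FF AND NOT MUC))%fm /\
  proves RCA0w_QFAC20 (Exists3 ⇔ (FF AND Z3 AND NOT MUC))%fm /\
  proves RCA0w_QFAC20 (Z3 ⇔ (Exists3 OR NOT Exists2))%fm /\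
  proves RCA0w_QFAC20
    ((Exists3 OR NOT Exists2) ⇔ (Exists3 OR NOT FF OR MUC))%fm.
Proof.
  (* All four claims follow by classical propositional logic from the three facts collected here. *)
  repeat split; apply RCA0w_QFAC20_complete; intros M HM HE HX;
    pose proof (Exists2_FF_not_MUC HM HE HX) as H1;
    pose proof (Exists3_Exists2_Z3 HM HE HX) as H2;
    pose proof (not_Exists2_Z3 HM HE HX) as H3;
    unfold Iff, Not; cbn [sat]; tauto.
Qed.
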